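(* Let $\alpha,\rho$ be the stability and positivity parameters of a stable process, with $\rho\in(0,1)$, and let $0<\delta<d<\frac{1}{\alpha\rho}$. Let $\{\Theta_n\}_{n\in\mathbb{Z}}$, $D=\{D_n\}_{n\in\mathbb{Z}}$, $\Xi=\{\Xi_n\}_{n\in\mathbb{Z}}$ and the function $a$ be as defined in the context, and let $$\sigma=\inf\{n>0:\ D_{-n}\le a(\Theta_{-n})\}\qquad(\inf\emptyset=\infty).$$ Then $\sigma<\infty$ almost surely. Moreover, $\mathbb{E}[\sigma\mid\Xi_0]<\infty$ almost surely.
   Context: Stable process. A (strictly) stable process with stability parameter $\alpha\in(0,2]$ is a real-valued Lévy process $Y=(Y_t)_{t\ge0}$ with $Y_0=0$ such that for every $c\ge 0$ the processes $(Y_{ct})_{t\ge0}$ and $(c^{1/\alpha}Y_t)_{t\ge0}$ have the same law; $\rho=\mathbb{P}(Y_1>0)$ is its positivity parameter. The law of $Y_1$ is normalised by $\mathbb{E}e^{itY_1}=\exp(-|t|^{\alpha}e^{-i\frac{\pi\alpha}{2}\theta\,\mathrm{sgn}(t)})$, $t\in\mathbb{R}$, with $\theta=2\rho-1$ (and $\mathrm{sgn}(t)=1$ for $t\ge0$, $-1$ for $t<0$). If $\alpha>1$ then $\rho\in[1-\frac1\alpha,\frac1\alpha]$. The cases $\rho\in\{0,1\}$ are excluded. The i.i.d. sequence. $\{\Theta_n\}_{n\in\mathbb{Z}}$ is an i.i.d. sequence, $\Theta_n=(S_n,U_n,W_n,\Lambda_n)$ with independent components taking values in $\mathcal{A}=(0,\infty)\times(0,1)\times(0,1)\times(0,1]$,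 where $S_n$ has the law of $Y_1$ conditioned on being positive, $U_n$ and $W_n$ are uniform on $(0,1)$, and $\Lambda_n$ has the law of $1+B(V^{1/\rho}-1)$ with $B$ Bernoulli, $\mathbb{P}(B=1)=1-\rho$, independent of $V$ uniform on $(0,1)$. The function $a$. For $\theta=(s,u,w,\lambda)\in\mathcal{A}$, $$a(\theta)=\left(\lambda^{-1/\alpha}-1\right)\left(\frac{1-u}{u}\right)^{1/\alpha}s .$$ The processes. For $n\in\mathbb{Z}$: (i) For integers $k<n$ let $I_k^n$ be the indicator of $\{S_k>e^{\delta(n-1-k)}\}$, and let $\chi_n=\min\{\,n-1,\ \inf\{k<n: I_k^n=1\}\}$ with $\inf\emptyset=\infty$; almost surely $-\infty<\chi_n\le n-1$ for all $n$. (ii) $F_n=d+\frac1\alpha\log(\Lambda_nU_n)$, and $C=\{C_n\}_{n\in\mathbb{Z}}$ is the random walk with $C_0=0$ and $C_{n+1}=C_n-F_n$ for all $n\in\mathbb{Z}$. (iii) $R_n=\sup_{k\le n}C_k-C_n$ (supremum over integers $k\le n$). (iv) $$D_n=e^{R_n}\left(\frac{e^{(d-\delta)(\chi_n-n)}}{1-e^{\delta-d}}+\sum_{k=\chi_n}^{n-1}e^{-(n-1-k)d}S_k(1-U_k)^{1/\alpha}\right).$$ (v) $$D_n''=\sum_{k\le n-1}e^{-(n-1-k)d}S_k,\qquad D_n'=e^{R_n}\left(\frac{1}{1-e^{\delta-d}}+D_n''\right).$$ (vi) $\Xi_n=(\Theta_n,R_n,D_n')$. *)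

(* Defs.v *)
From HB Require Import structures.
From mathcomp Require Import all_boot all_order all_algebra.
From mathcomp Require Import complex.
From mathcomp Require Import all_classical all_reals all_analysis.
From mathcomp Require Import measurable_realfun.

Set Implicit Arguments.
Unset Strict Implicit.
Unset Printing Implicit Defensive.

Import Order.TTheory GRing.Theory Num.Theory.
Import numFieldNormedType.Exports.

Local Open Scope classical_set_scope.
Local Open Scope ring_scope.

Section Probability.
Context {R : realType} {d : measure_display} {T : measurableType d}.
Variable P : probability T R.

Definition mutually_independent {I : eqType} {d' : measure_display}
    {E : measurableType d'} (X : I -> T -> E) : Prop :=
  forall (J : seq I) (B : I -> set E), uniq J ->
    (forall i, measurable (B i)) ->
    P [set w | forall i, i \in J -> B i (X i w)] =
    (\prod_(i <- J) fine (P (X i @^-1` B i)))%:E.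

Definition identically_distributed {I : Type} {d' : measure_display}
    {E : measurableType d'} (X : I -> T -> E) : Prop :=
  forall (i j : I) (B : set E), measurable B ->
    P (X i @^-1` B) = P (X j @^-1` B).

Definition iid {I : eqType} {d' : measure_display} {E : measurableType d'}
    (X : I -> T -> E) : Prop :=
  mutually_independent X /\ identically_distributed X.

Definition has_law (X : T -> R) (mu : set R -> \bar R) : Prop :=
  forall B : set R, measurable B -> P (X @^-1` B) = mu B.

(* The law of X conditioned on being positive; only used when P(X > 0) > 0. *)
Definition law_given_pos (X : T -> R) (B : set R) : \bar R :=
  (fine (P [set w | B (X w) /\ 0 < X w]) / fine (P [set w | 0 < X w]))%:E.

(* Z is a version of E[X | G] for a [0, +oo]-valued random variable X; no
   integrability of X is required. *)
Definition is_cond_expectation (G : set (set T)) (X Z : T -> \bar R) : Prop :=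
  [/\ sigma_algebra setT G /\ G `<=` measurable,
      measurable_fun setT X /\ (forall w, (0 <= X w)%E),
      (forall B : set (\bar R), measurable B -> G (Z @^-1` B)),
      (forall w, (0 <= Z w)%E) &
      forall A, G A -> (\int[P]_(w in A) Z w = \int[P]_(w in A) X w)%E].

(* The time set [0, +oo[ of a process is encoded by indexing over R and only
   ever looking at times t >= 0; the events of the path space are those of the
   cylinder sigma-algebra. *)
Definition path_events : set (set (R -> R)) :=
  <<s [set A | exists (t : R) (B : set R),
         [/\ 0 <= t, measurable B & A = [set f | B (f t)]]] >>.

Definition same_law (X Y : R -> T -> R) : Prop :=
  forall A, path_events A ->
    P [set w | A (fun t => X t w)] = P [set w | A (fun t => Y t w)].

Definition cadlag (f : R -> R) : Prop :=
  (forall t, 0 <= t -> f s @[s --> t^'+] --> f t) /\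
  (forall t, 0 < t -> cvg (f s @[s --> t^'-])).

Definition levy_process (Y : R -> T -> R) : Prop :=
  [/\ {ae P, forall w, Y 0 w = 0},
      (forall t : nat -> R, 0 <= t 0%N ->
         {homo t : i j / (i <= j)%N >-> i <= j} ->
         mutually_independent (fun (i : nat) w => Y (t i.+1) w - Y (t i) w)),
      (forall (s t : R) (B : set R), 0 <= s -> 0 <= t -> measurable B ->
         P [set w | B (Y (s + t) w - Y s w)] = P [set w | B (Y t w)]) &
      {ae P, forall w, cadlag (fun t => Y t w)}].

Definition stable_process (alpha : R) (Y : R -> T -> R) : Prop :=
  levy_process Y /\
  forall c : R, 0 <= c ->
    same_law (fun t => Y (c * t)) (fun t w => c `^ alpha^-1 * Y t w).

Definition cexp (z : R[i]) : R[i] :=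
  let: (x +i* y)%C := z in (expR x * cos y +i* (expR x * sin y))%C.

Definition char_fun (X : T -> R) (t : R) : R[i] :=
  (fine 'E_P[fun w => cos (t * X w)] +i*
   fine 'E_P[fun w => sin (t * X w)])%C.

(* exp(- |t|^alpha e^{-i (pi alpha / 2) theta sgn(t)}), theta = 2 rho - 1. *)
Definition stable_char_fun (alpha rho t : R) : R[i] :=
  let theta := 2 * rho - 1 in
  let sgn : R := if 0 <= t then 1 else -1 in
  cexp (- ((`|t| `^ alpha)%:C *
           cexp (0 +i* (- (pi * alpha / 2 * theta * sgn))))%C).

End Probability.

(* The law of 1 + B (V^{1/rho} - 1) for independent B ~ Bernoulli(1 - rho) and
   V uniform on (0, 1). *)
Definition Lambda_law {R : realType} (rho : R) : set R -> \bar R :=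
  pushforward (bernoulli_prob (1 - rho) \x uniform_prob (@ltr01 R))%E
    (fun bv : bool * R => 1 + bv.1%:R * (bv.2 `^ rho^-1 - 1)).

Section Processes.
Context {R : realType}.

(* The coordinates of theta = (s, u, w, lambda). *)
Local Notation quad := (R * R * R * R)%type.
Definition s_ (x : quad) : R := x.1.1.1.
Definition u_ (x : quad) : R := x.1.1.2.
Definition w_ (x : quad) : R := x.1.2.
Definition lambda_ (x : quad) : R := x.2.

Definition calA : set (quad) :=
  [set x | [/\ 0 < s_ x, 0 < u_ x < 1, 0 < w_ x < 1 & 0 < lambda_ x <= 1]].

Definition a_ (alpha : R) (x : quad) : R :=
  (lambda_ x `^ (- alpha^-1) - 1) * ((1 - u_ x) / u_ x) `^ alpha^-1 * s_ x.

(* The processes are defined path by path, x being a realisation of the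
   sequence Theta. Suprema, infima and infinite sums are taken in \bar R, so
   that no convention is needed on the null event where chi_n = -oo, R_n = +oo
   or D''_n = +oo. *)
Variables (alpha dlt d : R) (x : int -> quad).

Definition I_ (n k : int) : bool :=
  expR (dlt * (n - 1 - k)%:~R) < s_ (x k).

Definition chi_ (n : int) : \bar R :=
  Order.min (n - 1)%:~R%:E
    (ereal_inf [set k%:~R%:E | k in [set k : int | k < n /\ I_ n k]]).

Definition F_ (n : int) : R :=
  d + alpha^-1 * ln (lambda_ (x n) * u_ (x n)).

Definition C_ (n : int) : R :=
  match n with
  | Posz m => - \sum_(k < m) F_ (Posz k)
  | Negz m => \sum_(k < m.+1) F_ (Negz k)
  end.

Lemma C_0 : C_ 0 = 0.
Proof. by rewrite -[0 : int]/(Posz 0) /C_ big_ord0 oppr0. Qed.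

Lemma C_succ (n : int) : C_ (n + 1) = C_ n - F_ n.
Proof.
case: n => [m|[|m]].
- by rewrite -PoszD addn1 /= big_ord_recr/= opprD.
- by rewrite /= big_ord0 oppr0 big_ord_recr/= big_ord0 add0r subrr.
- have -> : Negz m.+1 + 1 = Negz m by rewrite !NegzE -addn1 PoszD opprD addrNK.
  by rewrite /= [in RHS]big_ord_recr/= addrK.
Qed.

Definition R_ (n : int) : \bar R :=
  (ereal_sup [set (C_ k)%:E | k in [set k : int | (k <= n)%R]] - (C_ n)%:E)%E.

Definition D_ (n : int) : \bar R :=
  (expeR (R_ n) *
   (expeR ((d - dlt)%:E * (chi_ n - n%:~R%:E)) * ((1 - expR (dlt - d))^-1)%:E +
    \esum_(k in [set k : int | (chi_ n <= k%:~R%:E) /\ (k <= n - 1)%R])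
      (expR (- (n - 1 - k)%:~R * d) * s_ (x k)
         * (1 - u_ (x k)) `^ alpha^-1)%:E))%E.

Definition D''_ (n : int) : \bar R :=
  (\esum_(k in [set k : int | (k <= n - 1)%R])
     (expR (- (n - 1 - k)%:~R * d) * s_ (x k))%:E)%E.

Definition D'_ (n : int) : \bar R :=
  (expeR (R_ n) * (((1 - expR (dlt - d))^-1)%:E + D''_ n))%E.

Definition Xi_ (n : int) : quad * \bar R * \bar R :=
  (x n, R_ n, D'_ n).

Definition sigma_ : \bar R :=
  ereal_inf [set n%:R%:E | n in
    [set n : nat | (0 < n)%N /\ (D_ (- n%:Z) <= (a_ alpha (x (- n%:Z)))%:E)%E]].

End Processes.

(* The sequence Theta_n = (S_n, U_n, W_n, Lambda_n), with S_n distributed as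
   Y_1 conditioned on being positive (Y1 lives on its own probability space). *)
Section Theta.
Context {R : realType} {d1 d2 : measure_display}
  {T1 : measurableType d1} {T2 : measurableType d2}.

Definition Theta_ (P : probability T2 R) (S U W L : int -> {RV P >-> R})
    (n : int) (w : T2) : R * R * R * R :=
  (S n w, U n w, W n w, L n w).

Definition Theta_sequence (P1 : probability T1 R) (Y1 : T1 -> R) (rho : R)
    (P : probability T2 R) (S U W L : int -> {RV P >-> R}) : Prop :=
  [/\ iid P (Theta_ S U W L),
      (forall n w, calA (Theta_ S U W L n w)),
      (forall n, mutually_independent P
         (tnth [tuple (S n : T2 -> R); (U n : T2 -> R);
                      (W n : T2 -> R); (L n : T2 -> R)])) &
      forall n, [/\ has_law P (S n) (law_given_pos P1 Y1),
                    has_law P (U n) (uniform_prob (@ltr01 R)),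
                    has_law P (W n) (uniform_prob (@ltr01 R)) &
                    has_law P (L n) (Lambda_law rho)]].

End Theta.

(* Main.v *)
Require Import Defs.
From HB Require Import structures.
From mathcomp Require Import all_boot all_order all_algebra.
From mathcomp Require Import complex.
From mathcomp Require Import all_classical all_reals all_analysis.
From mathcomp Require Import measurable_realfun.
From mathcomp Require Import ring lra zify.

(* The unconditional expectation of sigma is finite; this gives sigma < +oo a.s.,
   the existence of E[sigma | Xi_0] (Radon-Nikodym on the range of Xi_0), and its
   finiteness, since both have the same integral.

   Since D_n <= D'_n, the event D_n <= a(Theta_n) occurs as soon as a(Theta_n) is
   at least a suitable constant, the sums F_(n-1) + .. + F_(n-k) stay below a level
   M, and S_(n-1-k) <= exp (dlt (k + j0)) for all k. The probability that the
   k-th of these constraints fails is at most c t^k with t < 1 and c small: for F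
   by Chernoff's bound, as E exp (alpha s F) = exp (alpha s d) rho / (rho + s) < 1
   for small s > 0 because d < 1/(alpha rho); for S because
   1 - Re E exp (i t Y_1) = O(t^alpha) forces a polynomial tail.

   Among the times i, 2i, .., i^2, truncate the constraints to k < i: the resulting
   events are independent with probability bounded below, so all of them fail with
   exponentially small probability, and the truncation costs O(i t^i). Hence
   P(sigma > i^2) decays exponentially in i, which makes E sigma finite. *)

Set Implicit Arguments.
Unset Strict Implicit.
Unset Printing Implicit Defensive.

Import Order.TTheory GRing.Theory Num.Theory.
Import numFieldNormedType.Exports.
Local Open Scope classical_set_scope.
Local Open Scope ring_scope.

(** * Conditional expectation *)

(** Turns a bare set function into a bundled finite measure, so that the Radon-Nikodym theorem
    applies to it. *)
Lemma finite_measure_of (R : realType) (d : measure_display)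
    (E : measurableType d) (m : set E -> \bar R) :
  m set0 = 0%E -> (forall A, (0 <= m A)%E) -> semi_sigma_additive m ->
  fin_num_fun m ->
  exists mu : {finite_measure set E -> \bar R}, mu = m :> (set E -> \bar R).
Proof.
move=> m0 mge ms mfin.
pose m1 : {measure set E -> \bar R} := HB.pack m
  (isMeasure.Build _ _ _ m m0 mge ms).
pose mu : {finite_measure set E -> \bar R} := HB.pack m m1
  (Measure_isFinite.Build _ _ _ m1 mfin).
by exists mu.
Qed.

(** On [E], the set function sending [B] to the integral of [X] over the preimage of [B] is a finite
    measure dominated by the law of [f]. Its density [g] gives the version [g \o f], whose preimages
    lie in the sigma-algebra of [f] by construction. *)
Lemma cond_expectation_exists (R : realType) (d d' : measure_display)
    (T : measurableType d) (E : measurableType d') (P : probability T R)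
    (f : T -> E) (X : T -> \bar R) :
  measurable_fun setT f -> measurable_fun setT X -> (forall w, (0 <= X w)%E) ->
  (\int[P]_w X w < +oo)%E ->
  exists Z, is_cond_expectation P (g_sigma_algebra_preimage f) X Z.
Proof.
move=> mf mX X0 Xfin.
have mpre B : measurable B -> measurable (f @^-1` B).
  by move=> mB; rewrite -[X in measurable X]setTI; exact: mf.
pose m0 := pushforward P f.
have m00 : m0 set0 = 0%E by rewrite /m0 /pushforward preimage_set0 measure0.
have m0ge A : (0 <= m0 A)%E by exact: measure_ge0.
have m0s : semi_sigma_additive m0.
  move=> F mF tF mUF; rewrite /m0 /pushforward preimage_bigcup.
  apply: measure_semi_sigma_additive.
  - by move=> n; exact: mpre.
  - apply/trivIsetP => /= i j _ _ ij; rewrite -preimage_setI.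
    by move/trivIsetP : tF => /(_ _ _ _ _ ij) ->//; rewrite preimage_set0.
  - by rewrite -preimage_bigcup; exact: mpre.
have m0fin : fin_num_fun m0.
  by move=> A mA; apply: fin_num_measure; exact: mpre.
have [mu muE] := finite_measure_of m00 m0ge m0s m0fin.
pose n0 (B : set E) : \bar R := (\int[P]_(w in f @^-1` B) X w)%E.
have n00 : n0 set0 = 0%E by rewrite /n0 preimage_set0 integral_set0.
have n0ge A : (0 <= n0 A)%E by apply: integral_ge0.
have n0s : semi_sigma_additive n0.
  move=> F mF tF mUF; rewrite /n0 preimage_bigcup.
  apply: semi_sigma_additive_nng_induced => //.
  - by move=> n; exact: mpre.
  - apply/trivIsetP => /= i j _ _ ij; rewrite -preimage_setI.
    by move/trivIsetP : tF => /(_ _ _ _ _ ij) ->//; rewrite preimage_set0.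
  - by rewrite -preimage_bigcup; exact: mpre.
have n0fin : fin_num_fun n0.
  move=> A mA; rewrite ge0_fin_numE; last exact: n0ge.
  apply: le_lt_trans Xfin; apply: ge0_subset_integral => //.
  exact: mpre.
have [nu nuE] := finite_measure_of n00 n0ge n0s n0fin.
have numu : (nu `<< mu)%E.
  apply/null_content_dominatesP => A mA muA.
  have {}muA : P (f @^-1` A) = 0%E by rewrite -[LHS]/(m0 A) -muE.
  suff : n0 A = 0%E by rewrite -nuE.
  rewrite /n0; apply: null_set_integral muA; first exact: mpre.
  exact: measurable_funTS.
have [g [g0 gint gE]] := radon_nikodym_finite numu.
have mg : measurable_fun setT g by case/integrableP : gint.
exists (g \o f); split.
- split.
    by apply: sigma_algebra_preimage; exact: sigma_algebra_measurable.
  by move=> _ [B mB <-]; rewrite setTI; exact: mpre.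
- by [].
- move=> B mB; exists (g @^-1` B); last by rewrite setTI.
  by rewrite -[X in measurable X]setTI; exact: mg.
- by move=> w; exact: g0.
- move=> _ [B mB <-]; rewrite setTI.
  rewrite -(ge0_integral_pushforward mf)//; last exact: measurable_funTS.
  by rewrite -/m0 -muE -gE// nuE.
Qed.

Lemma integral_cond_expectation (R : realType) (d : measure_display)
    (T : measurableType d) (P : probability T R) (G : set (set T))
    (X Z : T -> \bar R) :
  is_cond_expectation P G X Z -> (\int[P]_w Z w = \int[P]_w X w)%E.
Proof.
move=> [[[G0 GC GU] _] _ _ _]; apply.
by rewrite -[setT]setC0 -setTD; exact: GC.
Qed.

Lemma ge0_integral_lty_ae (R : realType) (d : measure_display)
    (T : measurableType d) (mu : {measure set T -> \bar R})
    (X : T -> \bar R) :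
  measurable_fun setT X -> (forall w, (0 <= X w)%E) ->
  (\int[mu]_w X w < +oo)%E -> {ae mu, forall w, (X w < +oo)%E}.
Proof.
move=> mX X0 Xfin.
have intX : mu.-integrable setT X.
  apply/integrableP; split=> //.
  by under eq_integral do rewrite gee0_abs//.
apply: filterS (integrable_ae measurableT intX) => w /(_ I).
by rewrite ge0_fin_numE.
Qed.

(** * Independence of families of coordinates *)

Section IndependentSequence.
Context {R : realType} {d d' : measure_display} {T : measurableType d}
  {E : measurableType d'}.
Variables (P : probability T R) (X : nat -> T -> E).
Hypothesis mX : forall n, measurable_fun setT (X n).
Hypothesis indX : mutually_independent P X.

Let mpre n B : measurable B -> measurable (X n @^-1` B).
Proof. by move=> mB; rewrite -[Y in measurable Y]setTI; exact: mX. Qed.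

(** Finite intersections are built in, which makes the family a pi-system. *)
Definition cylinder (I : set nat) : set (set T) :=
  [set A | exists (J : seq nat) (B : nat -> set E),
    [/\ uniq J, (forall j, j \in J -> I j), (forall j, measurable (B j)) &
        A = [set w | forall j, j \in J -> B j (X j w)]]].

(* The events that depend only on the coordinates with index in I. *)
Definition sigma_coord (I : set nat) : set (set T) := <<s cylinder I >>.

Lemma cylinder_measurable I : cylinder I `<=` measurable.
Proof.
move=> _ [J [B [_ _ mB ->]]].
rewrite (_ : [set _ | _] = \bigcap_(j in [set` J]) (X j @^-1` B j)); last first.
  by apply/seteqP; split=> [w H j /=|w H j /= jJ]; [exact: H|exact: (H j jJ)].
by apply: bigcap_measurableType => j _; exact: mpre.
Qed.

Lemma sigma_coord_measurable I : sigma_coord I `<=` measurable.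
Proof.
apply: smallest_sub; first exact: sigma_algebra_measurable.
exact: cylinder_measurable.
Qed.

Lemma cylinder_setI I : setI_closed (cylinder I).
Proof.
move=> _ _ [J1 [B1 [u1 s1 m1 ->]]] [J2 [B2 [u2 s2 m2 ->]]].
exists (undup (J1 ++ J2)), (fun j => (if j \in J1 then B1 j else setT) `&`
  (if j \in J2 then B2 j else setT)); split.
- exact: undup_uniq.
- by move=> j; rewrite mem_undup mem_cat => /orP[/s1|/s2].
- by move=> j; apply: measurableI; case: ifP.
- apply/seteqP; split=> w /=.
    by move=> [h1 h2] j _; split; case: ifP => // /[dup] h; [move/h1|move/h2].
  move=> h; split=> j jJ; have := h j; rewrite mem_undup mem_cat jJ ?orbT.
    by move=> /(_ isT)[].
  by move=> /(_ isT)[].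
Qed.

Lemma cylinder_independent I1 I2 A B : (forall j, I1 j -> ~ I2 j) ->
  cylinder I1 A -> cylinder I2 B -> P (A `&` B) = (P A * P B)%E.
Proof.
move=> dis [J1 [B1 [u1 s1 m1 ->]]] [J2 [B2 [u2 s2 m2 ->]]].
have nJ j : j \in J2 -> j \notin J1.
  by move=> /s2 j2; apply/negP => /s1 /dis.
pose C j := if j \in J1 then B1 j else B2 j.
have -> : [set w | forall j, j \in J1 -> B1 j (X j w)] `&`
    [set w | forall j, j \in J2 -> B2 j (X j w)] =
    [set w | forall j, j \in J1 ++ J2 -> C j (X j w)].
  apply/seteqP; split=> w /=.
    move=> [h1 h2] j; rewrite /C mem_cat; case: ifPn => [/h1//|_ /= /h2//].
  move=> h; split=> j jJ; have := h j; rewrite /C mem_cat jJ ?orbT.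
    by apply.
  by rewrite (negbTE (nJ _ jJ)); apply.
rewrite !indX//.
- rewrite big_cat/= EFinM; congr (_%:E * _%:E)%E.
    by rewrite !big_seq; apply: eq_bigr => j jJ; rewrite /C jJ.
  by rewrite !big_seq; apply: eq_bigr => j jJ; rewrite /C (negbTE (nJ _ jJ)).
- rewrite cat_uniq u1 u2 andbT /=; apply/hasPn => j; exact: nJ.
- by move=> j; rewrite /C; case: ifP.
Qed.

(** Prepares Dynkin's pi-lambda argument: independence of a fixed event passes to complements and to
    disjoint countable unions. *)
Let indep_lambda (B : set T) : measurable B ->
  lambda_system setT [set A | measurable A /\ P (A `&` B) = (P A * P B)%E].
Proof.
move=> mB; apply/dynkin_lambda_system; split.
- by split=> //; rewrite setTI probability_setT mul1e.
- move=> A [mA hA]; split; first exact: measurableC.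
  have PB : P B = (P (A `&` B) + P (~` A `&` B))%E.
    rewrite -measureU//.
    + by rewrite -setIUl setUCr setTI.
    + exact: measurableI.
    + by apply: measurableI => //; exact: measurableC.
    + by rewrite setIACA setICr set0I.
  have /fineK PBf := fin_num_measure P B mB.
  have /fineK PAf := fin_num_measure P A mA.
  have /fineK PABf := fin_num_measure P _ (measurableI _ _ (measurableC mA) mB).
  rewrite probability_setC//.
  move: PB; rewrite hA -PBf -PAf -PABf -!EFinM -EFinD.
  move=> [h]; congr (_%:E).
  by rewrite mulrBl mul1r [X in _ = X - _]h addrAC subrr add0r.
- move=> F tF hF; have mF n : measurable (F n) by have [] := hF n.
  split; first exact: bigcupT_measurable.
  rewrite setI_bigcupl measure_bigcup//=; last 2 first.
  + by move=> n _; exact: measurableI.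
  + exact: trivIset_setIr.
  rewrite [X in (X * _)%E]measure_bigcup//=.
  have /fineK PBf := fin_num_measure P B mB.
  rewrite muleC -PBf -nneseriesZl//.
  by apply: eq_eseriesr => n _; rewrite PBf muleC; have [] := hF n.
Qed.

(** The pi-lambda theorem is applied twice: first a cylinder over [I1] is fixed and the event over
    [I2] is made general, then that event is fixed and the one over [I1] is made general. *)
Lemma sigma_coord_independent I1 I2 A B : (forall j, I1 j -> ~ I2 j) ->
  sigma_coord I1 A -> sigma_coord I2 B -> P (A `&` B) = (P A * P B)%E.
Proof.
move=> dis sA sB.
have cB C : cylinder I1 C -> P (C `&` B) = (P C * P B)%E.
  move=> cC; rewrite setIC muleC.
  have := @lambda_system_subset _ _ (@cylinder_setI I2) setT _
    (indep_lambda (cylinder_measurable cC)).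
  case/(_ _ _ _ sB) => //.
  move=> D cD; split; first exact: cylinder_measurable cD.
  by rewrite setIC muleC; exact: cylinder_independent dis cC cD.
have mB := sigma_coord_measurable sB.
have := @lambda_system_subset _ _ (@cylinder_setI I1) setT _ (indep_lambda mB).
case/(_ _ _ _ sA) => //.
by move=> D cD; split; [exact: cylinder_measurable cD|exact: cB].
Qed.

Lemma sigma_coord_sub I1 I2 : I1 `<=` I2 -> sigma_coord I1 `<=` sigma_coord I2.
Proof.
move=> sI; apply: smallest_sub; first exact: smallest_sigma_algebra.
move=> _ [J [B [uJ sJ mB ->]]]; apply: sub_gen_smallest.
by exists J, B; split=> // j /sJ /sI.
Qed.

Lemma measurable_coord (I : set nat) n : I n ->
  @measurable_fun _ _ (g_sigma_algebraType (cylinder I)) E setT (X n).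
Proof.
move=> In _ B mB; apply: sub_gen_smallest; rewrite setTI.
exists [:: n], (fun=> B); split=> //.
- by move=> j; rewrite inE => /eqP ->.
- apply/seteqP; split=> w /=; first by move=> h j; rewrite inE => /eqP ->.
  by apply; rewrite inE.
Qed.

End IndependentSequence.

(** * Return times of independent blocks *)

Lemma nneseries_geometric (R : realType) (a y : R) : 0 <= a -> 0 <= y < 1 ->
  (\sum_(0 <= i <oo) (a * y ^+ i)%:E = (a / (1 - y))%:E)%E.
Proof.
move=> a0 /andP[y0 y1].
have cv : series (geometric a y) @ \oo --> a * (1 - y)^-1.
  by apply: cvg_geometric_series; rewrite ger0_norm.
rewrite -(cvg_lim _ cv)// -EFin_lim; last by apply/cvg_ex; eexists; exact: cv.
by congr (limn _); apply/funext => n /=; rewrite -sumEFin.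
Qed.

Lemma measure_union_geometric (R : realType) (d : measure_display)
    (T : measurableType d) (P : probability T R) (A : nat -> set T) (B : set T)
    (c t : R) :
  0 <= c -> 0 <= t < 1 -> (forall k, measurable (A k)) -> measurable B ->
  (forall k, (P (A k) <= (c * t ^+ k)%:E)%E) -> B `<=` \bigcup_k A k ->
  (P B <= (c / (1 - t))%:E)%E.
Proof.
move=> c0 t01 mA mB PA BA.
apply: (@le_trans _ _ (\sum_(0 <= k <oo) P (A k))%E).
  exact: measure_sigma_subadditive.
rewrite -nneseries_geometric//; exact: lee_nneseries.
Qed.

(* [(i+1) y^i <= 1 + y + .. + y^i <= 1/(1-y)]; raising this to a power absorbs any
   polynomial factor into a geometric sequence. *)
Lemma succn_mul_expr_le (R : realFieldType) (y : R) (i : nat) : 0 <= y < 1 ->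
  i.+1%:R * y ^+ i <= (1 - y)^-1.
Proof.
move=> /andP[y0 y1]; rewrite -[leRHS]mul1r ler_pdivlMr ?subr_gt0//.
have h : i.+1%:R * y ^+ i <= \sum_(k < i.+1) y ^+ k.
  rewrite mulr_natl -[X in _ *+ X]card_ord -sumr_const ler_sum// => k _.
  by rewrite ler_wiXn2l// ?(ltW y1)// -ltnS ltn_ord.
apply: (@le_trans _ _ ((\sum_(k < i.+1) y ^+ k) * (1 - y))).
  by rewrite ler_wpM2r// subr_ge0 ltW.
rewrite mulrC -opprB mulNr -subrX1 opprB lerBlDr lerDl.
exact: exprn_ge0.
Qed.

Lemma poly_geometric_summable (R : realType) (s : R) : 0 < s < 1 ->
  (\sum_(0 <= i <oo) ((2 * i + 3)%:R * ((i.+2)%:R * s ^+ i))%:E < +oo)%E.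
Proof.
move=> /andP[s0 s1].
(* A fourth root: as [2 i + 3 <= 2 (i + 2)], one factor [y ^+ i] absorbs each of the two linear
   terms, and what is left is still summable. *)
pose y := Num.sqrt (Num.sqrt s).
have y0 : 0 <= y by exact: sqrtr_ge0.
have y4 : s = y ^+ 4.
  by rewrite (exprM y 2 2) sqr_sqrtr ?sqrtr_ge0// sqr_sqrtr// ltW.
have y1 : y < 1.
  by rewrite -(@ltr_pXn2r _ 4)// ?nnegrE// -y4 expr1n.
have y01 : 0 <= y < 1 by rewrite y0.
pose K := 2 * (1 - y)^-1.
have K0 : 0 <= K by rewrite mulr_ge0// invr_ge0 subr_ge0 ltW.
have hK i : i.+2%:R * y ^+ i <= K.
  apply: (@le_trans _ _ (2 * (i.+1%:R * y ^+ i))).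
    rewrite mulrA ler_wpM2r ?exprn_ge0// -natrM ler_nat.
    by rewrite mul2n -addnn addSn addnS ltnS ltnS leq_addr.
  by rewrite ler_wpM2l// succn_mul_expr_le.
apply: (@le_lt_trans _ _ (\sum_(0 <= i <oo) (2 * K ^+ 2 * y ^+ i)%:E)%E).
  apply: lee_nneseries => i _.
    by move=> _; rewrite lee_fin !mulr_ge0// exprn_ge0// ltW.
  rewrite lee_fin.
  apply: (@le_trans _ _ ((2 * i.+2%:R) * (i.+2%:R * s ^+ i))).
    rewrite ler_wpM2r ?mulr_ge0 ?exprn_ge0 ?(ltW s0)//.
    by rewrite -natrM ler_nat !mulnS addnA addnC leq_add2r.
  have -> : 2 * i.+2%:R * (i.+2%:R * s ^+ i) =
      2 * (i.+2%:R * y ^+ i) ^+ 2 * (y ^+ i * y ^+ i).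
    by rewrite y4 -exprM mulnC exprM; ring.
  apply: (@le_trans _ _ (2 * K ^+ 2 * (y ^+ i * y ^+ i))).
    rewrite ler_wpM2r ?mulr_ge0 ?exprn_ge0// ler_wpM2l// lerXn2r ?nnegrE//.
    by rewrite mulr_ge0// exprn_ge0.
  apply: ler_wpM2l; first by apply: mulr_ge0 => //; exact: exprn_ge0.
  by apply: ler_piMr; [exact: exprn_ge0|apply: exprn_ile1 => //; exact: ltW].
by rewrite nneseries_geometric ?ltry// mulr_ge0 ?exprn_ge0.
Qed.

(* [X <= 1 + \sum_i (2 i + 3) 1_(Fail i)], since [(i+1)^2] increases by [2 i + 3]. *)
Lemma integral_lty_quadratic (R : realType) (d : measure_display)
    (T : measurableType d) (P : probability T R) (X : T -> \bar R)
    (Fail : nat -> set T) (s : R) :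
  measurable_fun setT X -> (forall w, (0 <= X w)%E) -> 0 < s < 1 ->
  (forall i, measurable (Fail i)) ->
  (forall i, (P (Fail i) <= (i.+2%:R * s ^+ i)%:E)%E) ->
  (forall i w, ~ Fail i w -> (X w <= (i.+1 ^ 2)%:R%:E)%E) ->
  (\int[P]_w X w < +oo)%E.
Proof.
move=> mX X0 s01 mF PF XF.
pose f i (w : T) : \bar R := ((2 * i + 3)%:R%:E * (\1_(Fail i) w)%:E)%E.
have mf i : measurable_fun setT (f i).
  by apply: measurable_funeM; apply/measurable_EFinP; exact: measurable_indic.
have f0 i w : (0 <= f i w)%E by rewrite mule_ge0// lee_fin.
(* The numbers [2 i + 3] for [i < n] add up to [(n + 1)^2 - 1]. *)
have lef w n : (forall i, (i < n)%N -> Fail i w) ->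
    ((n.+1 ^ 2)%:R%:E <= 1 + \sum_(0 <= i <oo) f i w)%E.
  move=> Fw; apply: le_trans (leeD2l _ (nneseries_lim_ge n _)); last by [].
  have -> : (\sum_(0 <= i < n) f i w = \sum_(0 <= i < n) ((2 * i + 3)%:R)%:E)%E.
    rewrite !big_nat; apply: eq_bigr => i /andP[_ in_].
    by rewrite /f indicE mem_set ?mule1//; exact: Fw.
  rewrite sumEFin -natr_sum -[1%E]/(1%:R%:E) -EFinD -natrD lee_fin ler_nat.
  elim: n {Fw} => [|n IH]; first by rewrite big_nil.
  by rewrite big_nat_recr//= addnA (leq_trans _ (leq_add IH (leqnn _)))//; lia.
have Xle w : (X w <= 1 + \sum_(0 <= i <oo) f i w)%E.
  (* Either there is a first index that does not fail, and the bound at that index is used, or every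
     index fails and the right-hand side is infinite. *)
  have [[i Fi]|nF] := pselect (exists i, ~~ `[< Fail i w >]).
    have [m Fm mmin] := ex_minnP (ex_intro (fun i => ~~ `[< Fail i w >]) i Fi).
    apply: le_trans (XF m w (elimN (asboolP _) Fm)) (lef w m _) => l lm.
    by apply/asboolP; apply: contraT => /mmin; rewrite leqNgt lm.
  have Fw i : Fail i w.
    by apply: contrapT => h; apply: nF; exists i; apply/asboolPn.
  suff -> : (1 + \sum_(0 <= i <oo) f i w = +oo)%E by rewrite leey.
  apply/eqyP => A A0; have := lef w (Num.bound A) (fun i _ => Fw i).
  apply: le_trans; rewrite lee_fin.
  apply: le_trans (ltW (archi_boundP (ltW A0))) _.
  by rewrite ler_nat; lia.
apply: (@le_lt_trans _ _ (\int[P]_w (1 + \sum_(0 <= i <oo) f i w))%E).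
  apply: ge0_le_integral => //.
  apply: emeasurable_funD => //.
  by apply: ge0_emeasurable_sum.
rewrite ge0_integralD//=; last 2 first.
- by move=> w _; apply: nneseries_ge0 => i _ _; exact: f0.
- by apply: ge0_emeasurable_sum.
rewrite integral_cst// mul1e.
rewrite integral_nneseries//.
apply: lte_add_pinfty.
  by apply: le_lt_trans (probability_le1 P measurableT) _; exact: ltry.
apply: le_lt_trans (poly_geometric_summable s01).
apply: lee_nneseries => i _; first by move=> _; exact: integral_ge0.
rewrite /f ge0_integralZl_EFin//; last first.
  by apply/measurable_EFinP; exact: measurable_indic.
rewrite integral_indic// setIT EFinM lee_pmul//.
exact: PF.
Qed.

Section ReturnTime.
Context {R : realType} {d d' : measure_display} {T : measurableType d}
  {E : measurableType d'}.
Variables (P : probability T R) (X : nat -> T -> E).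
Hypothesis mX : forall n, measurable_fun setT (X n).
Hypothesis indX : mutually_independent P X.
Variables (Good : nat -> set T) (Bad : nat -> nat -> set T) (q c t : R).
Hypothesis q0 : 0 < q.
Hypothesis c0 : 0 <= c.
Hypothesis t01 : 0 <= t < 1.
Hypothesis ct : c / (1 - t) <= 2^-1.
Hypothesis sGood : forall n, sigma_coord X [set n] (Good n).
Hypothesis PGood : forall n, (q%:E <= P (Good n))%E.
Hypothesis sBad : forall n k,
  sigma_coord X [set j | (n < j <= n + k.+1)%N] (Bad n k).
Hypothesis PBad : forall n k, (P (Bad n k) <= (c * t ^+ k)%:E)%E.

Let msub I A : sigma_coord X I A -> measurable A.
Proof. by move=> /(sigma_coord_measurable mX). Qed.

(* Truncating the range of the bad events makes [Hit n m] independent for well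
   separated [n]. *)
Let Hit n m := Good n `&` \bigcap_(k in `I_m) ~` Bad n k.

Let sHit n m : sigma_coord X [set j | (n <= j <= n + m)%N] (Hit n m).
Proof.
apply: (@measurableI _ (g_sigma_algebraType (cylinder X _))).
  by apply: sigma_coord_sub (@sGood n) => j /= ->; rewrite leqnn leq_addr.
apply: (@bigcap_measurableType _ (g_sigma_algebraType (cylinder X _))) => k /= km.
apply: (@measurableC _ (g_sigma_algebraType (cylinder X _))).
apply: sigma_coord_sub (@sBad n k) => j /= /andP[nj jk].
by rewrite (ltnW nj) (leq_trans jk)// leq_add2l.
Qed.

(** [Good n] reads coordinate [n] and the bad events read later ones, so the probabilities multiply;
    by the union bound and [ct], no bad event occurs with probability at least one half. *)
Let PHit n m : ((q / 2)%:E <= P (Hit n m))%E.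
Proof.
have sN : sigma_coord X [set j | (n < j <= n + m)%N]
    (\bigcap_(k in `I_m) ~` Bad n k).
  apply: (@bigcap_measurableType _ (g_sigma_algebraType (cylinder X _))) => k /= km.
  apply: (@measurableC _ (g_sigma_algebraType (cylinder X _))).
  apply: sigma_coord_sub (@sBad n k) => j /= /andP[-> jk] /=.
  by rewrite (leq_trans jk)// leq_add2l.
rewrite (sigma_coord_independent mX indX _ (@sGood n) sN); last first.
  by move=> j /= ->; rewrite ltnn.
rewrite EFinM lee_pmul ?lee_fin ?(ltW q0)//.
have : (P (~` \bigcap_(k in `I_m) ~` Bad n k) <= (2^-1)%:E)%E.
  apply: (@le_trans _ _ (c / (1 - t))%:E); last by rewrite lee_fin.
  apply: (measure_union_geometric c0 t01 (A := Bad n)) => //.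
  - by move=> k; exact: msub (@sBad n k).
  - exact: measurableC (msub sN).
  - by rewrite setC_bigcap => w [k _ /contrapT h]; exists k.
rewrite probability_setC; last exact: msub sN.
have /fineK <- := fin_num_measure P _ (msub sN).
rewrite -EFinB !lee_fin; lra.
Qed.

(** The trial times are [i + 1] apart while each trial reads only [i] coordinates ahead, so the
    blocks read are disjoint. *)
Let Miss i J := \bigcap_(j in `I_J) ~` Hit (i.+1 * j.+1) i.

Let sMiss i J : sigma_coord X [set l | (l < i.+1 * J.+1)%N] (Miss i J).
Proof.
apply: (@bigcap_measurableType _ (g_sigma_algebraType (cylinder X _))) => j /= jJ.
apply: (@measurableC _ (g_sigma_algebraType (cylinder X _))).
apply: sigma_coord_sub (@sHit _ _) => l /= /andP[_ h].
by apply: leq_ltn_trans h _; nia.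
Qed.

Let q1 : q <= 1.
Proof.
rewrite -lee_fin; apply: le_trans (PGood 0) _.
by apply: probability_le1; exact: msub (@sGood 0).
Qed.

(** Induction on [J]: the new trial reads coordinates from [(i + 1)(J + 1)] on, the earlier ones
    only coordinates below that. *)
Let PMiss i J : (P (Miss i J) <= ((1 - q / 2) ^+ J)%:E)%E.
Proof.
elim: J => [|J IH].
  by apply: probability_le1; exact: msub (@sMiss i 0).
have -> : Miss i J.+1 = Miss i J `&` ~` Hit (i.+1 * J.+1) i.
  apply/seteqP; split=> [w h|w [h1 h2] j /=].
    by split; [move=> j /= jJ; apply: h; exact: ltnW|exact: h _ (ltnSn J)].
  by rewrite ltnS leq_eqVlt => /predU1P[->//|/h1].
have sC : sigma_coord X [set l | (i.+1 * J.+1 <= l)%N]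
    (~` Hit (i.+1 * J.+1) i).
  apply: (@measurableC _ (g_sigma_algebraType (cylinder X _))).
  by apply: sigma_coord_sub (@sHit _ _) => l /= /andP[].
rewrite (sigma_coord_independent mX indX _ (@sMiss i J) sC); last first.
  by move=> l /=; rewrite ltnNge => /negP.
rewrite exprSr EFinM lee_pmul// probability_setC; last exact: msub (@sHit _ _).
have := PHit (i.+1 * J.+1) i.
have /fineK <- := fin_num_measure P _ (msub (@sHit (i.+1 * J.+1) i)).
rewrite -EFinB !lee_fin; lra.
Qed.

(** Collects the constraints dropped by the truncation, for all [i + 1] trials at once. *)
Let Late i := \bigcup_(j in `I_i.+1) \bigcup_k Bad (i.+1 * j.+1) (k + i).

Let mLate1 i j : measurable (\bigcup_k Bad (i.+1 * j.+1) (k + i)).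
Proof. by apply: bigcupT_measurable => k; exact: msub (@sBad _ _). Qed.

Let PLate i : (P (Late i) <= (i.+1%:R * (2^-1 * t ^+ i))%:E)%E.
Proof.
apply: (@le_trans _ _ (\sum_(j < i.+1) (2^-1 * t ^+ i)%:E)%E); last first.
  by rewrite sumEFin sumr_const card_ord mulr_natl.
apply: (@le_trans _ _
    (\sum_(j < i.+1) P (\bigcup_k Bad (i.+1 * j.+1) (k + i)))%E).
  have := @content_subadditive _ _ _ P (Late i)
    (fun j => \bigcup_k Bad (i.+1 * j.+1) (k + i)) i.+1; apply.
  - by move=> j _; exact: mLate1.
  - by apply: bigcup_measurable => j _; exact: mLate1.
  - by rewrite /Late bigcup_mkord.
apply: lee_sum => j _.
have t0 : 0 <= t by case/andP : t01.
apply: (@le_trans _ _ ((c * t ^+ i) / (1 - t))%:E).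
  apply: (measure_union_geometric _ t01 (A := fun k => Bad (i.+1 * j.+1) (k + i))).
  - by rewrite mulr_ge0// exprn_ge0.
  - by move=> k; exact: msub (@sBad _ _).
  - exact: mLate1.
  - by move=> k; rewrite -mulrA -exprD addnC; exact: PBad.
  - by [].
by rewrite lee_fin mulrAC ler_wpM2r// exprn_ge0.
Qed.

(** Outside [Miss i i.+1] and [Late i], some trial at a time at most [(i + 1)^2] meets all its
    constraints, truncated or not; both exceptional events decay geometrically up to a linear
    factor. *)
Lemma integral_return_time (sigma : T -> \bar R) :
  measurable_fun setT sigma -> (forall w, (0 <= sigma w)%E) ->
  (forall n w, (0 < n)%N -> Good n w -> (forall k, ~ Bad n k w) ->
    (sigma w <= n%:R%:E)%E) ->
  (\int[P]_w sigma w < +oo)%E.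
Proof.
move=> ms s0 hs.
(* One rate dominating both decays; the entry [2^-1] makes its positivity immediate. *)
pose s := Num.max (1 - q / 2) (Num.max t 2^-1).
have s01 : 0 < s < 1.
  rewrite /s !lt_max !gt_max; case/andP : t01 => _ ->; rewrite invr_gt0 ltr0n.
  by rewrite !orbT /= gtrBl divr_gt0// invf_lt1// ltr1n.
have sq : 1 - q / 2 <= s by rewrite le_max lexx.
have st : t <= s by rewrite !le_max lexx orbT.
apply: (integral_lty_quadratic (Fail := fun i => Miss i i.+1 `|` Late i) ms s0 s01).
- move=> i; apply: measurableU; first exact: msub (@sMiss _ _).
  by apply: bigcup_measurable => j _; exact: mLate1.
- move=> i.
  have q2 : 0 <= 1 - q / 2.
    by rewrite subr_ge0 ler_pdivrMr// mul1r (le_trans q1)// ler1n.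
  have q3 : 1 - q / 2 <= 1 by rewrite gerBl divr_ge0// ltW.
  have s0' : 0 <= s by case/andP : s01 => /ltW.
  apply: (@le_trans _ _ (P (Miss i i.+1) + P (Late i))%E).
    apply: measureU2; first exact: msub (@sMiss _ _).
    by apply: bigcup_measurable => j _; exact: mLate1.
  apply: (@le_trans _ _ ((1 - q / 2) ^+ i.+1 + i.+1%:R * (2^-1 * t ^+ i))%:E).
    by rewrite EFinD; apply: leeD; [exact: PMiss|exact: PLate].
  rewrite lee_fin -[i.+2]add1n natrD mulrDl mul1r; apply: lerD.
    rewrite exprSr; apply: (@le_trans _ _ ((1 - q / 2) ^+ i)).
      by rewrite ler_piMr ?exprn_ge0.
    by rewrite lerXn2r// nnegrE.
  rewrite ler_wpM2l//; apply: (@le_trans _ _ (t ^+ i)).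
    by rewrite ler_piMl ?exprn_ge0//; [case/andP : t01|rewrite invf_le1// ler1n].
  by rewrite lerXn2r// nnegrE//; case/andP : t01.
- move=> i w; rewrite not_orE => -[nM nL].
  have [j /= ji Hj] : exists2 j, (j < i.+1)%N & Hit (i.+1 * j.+1) i w.
    apply: contrapT => h; apply: nM => j /= ji hit; apply: h; by exists j.
  have [Gj Bj] := Hj.
  apply: (@le_trans _ _ (i.+1 * j.+1)%:R%:E); last first.
    by rewrite lee_fin ler_nat; nia.
  apply: hs => // k Bk; have [ki|ik] := ltnP k i; first exact: (Bj k ki).
  by apply: nL; exists j => //; exists (k - i)%N => //; rewrite subnK.
Qed.

End ReturnTime.

(** * Laws, moments and tails *)

(* [measurableTypeR R], on which [uniform_prob] is a measure, carries the same
   measurable sets as [R] under another display. *)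
Lemma integral_has_law (R : realType) (d : measure_display)
    (T : measurableType d) (P : probability T R) (X : {RV P >-> R})
    (mu : {measure set (measurableTypeR R) -> \bar R}) (g : R -> \bar R) :
  has_law P X mu -> measurable_fun setT g -> (forall x, (0 <= g x)%E) ->
  (\int[P]_w g (X w) = \int[mu]_x g x)%E.
Proof.
move=> XE mg g0.
pose X' : T -> measurableTypeR R := X.
have mX' : measurable_fun setT X' by exact: (measurable_funP X).
pose X'' : {mfun T >-> measurableTypeR R} := mfun_Sub (mem_set mX').
rewrite [RHS](eq_measure_integral (distribution P X'')); last first.
  by move=> A mA _; rewrite -XE.
by rewrite ge0_integral_distribution.
Qed.

Lemma integral_powR01 (R : realType) (s : R) : 0 < s ->
  (\int[lebesgue_measure]_(x in `[0%R, 1%R]) (x `^ s)%:E = ((1 + s)^-1)%:E)%E.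
Proof.
move=> s0; have s1 : 0 < 1 + s by lra.
(* Used with exponent [s] for the continuity of the integrand and with [1 + s] for the
   antiderivative. *)
have LR p : 0 < p -> derivable_oo_LRcontinuous (fun x : R => x `^ p) 0 1.
  move=> p0; split.
  - by move=> x; rewrite in_itv/= => /andP[x0 _]; apply: derivable_powR;
      rewrite in_itv/= x0.
  - by rewrite powR0 ?gt_eqF//; exact: powR_cvg0.
  - have : derivable (fun x : R => x `^ p) 1 1.
      by apply: derivable_powR; rewrite in_itv/= ltr01.
    by move=> /derivable1_diffP/differentiable_continuous; exact: cvg_at_left_filter.
rewrite (@continuous_FTC2 _ _ (fun x => (1 + s)^-1 * x `^ (1 + s)))//.
- by rewrite powR0 ?gt_eqF// powR1 mulr0 mulr1 sube0.
- by apply: derivable_oo_LRcontinuous_within; exact: LR.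
- have [h1 h2 h3] := LR _ s1; split.
  + by move=> x /h1 dx; apply: derivableM => //; exact: derivable_cst.
  + by apply: cvgM => //; exact: cvg_cst.
  + by apply: cvgM => //; exact: cvg_cst.
- move=> x; rewrite in_itv/= => /andP[x0 _].
  rewrite derive1E deriveZ; last by apply: derivable_powR; rewrite in_itv/= x0.
  rewrite -derive1E powR_derive1 ?in_itv/= ?x0//.
  by rewrite /GRing.scale/= mulrA mulVf ?gt_eqF// mul1r addrAC subrr add0r.
Qed.

Lemma integral_uniform_powR (R : realType) (s : R) : 0 < s ->
  (\int[uniform_prob (@ltr01 R)]_x (x `^ s)%:E = ((1 + s)^-1)%:E)%E.
Proof.
move=> s0; rewrite integral_uniform.
- by rewrite subr0 invr1 mul1e integral_powR01.
- by apply/measurable_EFinP.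
- by move=> x; rewrite lee_fin powR_ge0.
Qed.

(** Tonelli over the Bernoulli variable: the value 0, of probability [rho], gives an atom at 1, and
    the value 1 gives [V^(1/rho)]. *)
Lemma integral_has_Lambda_law (R : realType) (d : measure_display)
    (T : measurableType d) (P : probability T R) (L : {RV P >-> R})
    (rho : R) (g : R -> \bar R) :
  0 < rho < 1 -> has_law P L (Lambda_law rho) ->
  measurable_fun setT g -> (forall x, (0 <= g x)%E) ->
  (\int[P]_w g (L w) = rho%:E * g 1%R +
     (1 - rho)%:E * \int[uniform_prob (@ltr01 R)]_v g (v `^ rho^-1)%R)%E.
Proof.
move=> /andP[rho0 rho1] LE mg g0.
pose phi (bv : bool * measurableTypeR R) : measurableTypeR R :=
  1 + bv.1%:R * (bv.2 `^ rho^-1 - 1).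
have mphi : measurable_fun setT phi.
  apply: measurable_funD => //; apply: measurable_funM => /=.
    by apply: (measurableT_comp (f := fun b : bool => b%:R : R)) => //.
  apply: measurable_funB => //.
  exact: (measurableT_comp (@measurable_powR R rho^-1) measurable_snd).
pose b : probability bool R := bernoulli_prob (1 - rho).
pose u : probability (measurableTypeR R) R := uniform_prob (@ltr01 R).
pose m : probability (bool * measurableTypeR R)%type R := (b \x u)%E.
pose Phi : {mfun _ >-> measurableTypeR R} := mfun_Sub (mem_set mphi).
rewrite (integral_has_law (mu := distribution m Phi))//.
rewrite ge0_integral_distribution//.
have mgp : measurable_fun setT (g \o phi) by exact: measurableT_comp.
rewrite (_ : (_ \o _) = g \o phi)//.
rewrite /m fubini_tonelli1//; last by move=> x; exact: g0.
rewrite integral_bernoulli_prob; last 2 first.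
- by rewrite subr_ge0 (ltW rho1) lerBlDr lerDl ltW.
- by move=> y; apply: integral_ge0 => v _; exact: g0.
rewrite addeC; congr (_ + _)%E.
  rewrite -[X in unstable.onem X]/(unstable.onem rho) unstable.onemK.
  congr (_ * _)%E.
  rewrite /fubini_F/=; under eq_integral do rewrite /= /phi /= mul0r addr0.
  rewrite integral_cst// [X in (_ * X)%E](_ : _ = 1%E) ?mule1//.
  exact: (probability_setT u).
congr (_ * _)%E; rewrite /fubini_F/=; apply: eq_integral => v _.
by rewrite /= /phi/= mul1r addrCA subrr addr0.
Qed.

(** The factor [1 + s] will cancel against the moment [1 / (1 + s)] of a uniform variable. *)
Lemma integral_Lambda_powR (R : realType) (d : measure_display)
    (T : measurableType d) (P : probability T R) (L : {RV P >-> R})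
    (rho s : R) :
  0 < rho < 1 -> 0 < s -> has_law P L (Lambda_law rho) ->
  (\int[P]_w (L w `^ s)%:E = (rho * (1 + s) / (rho + s))%:E)%E.
Proof.
move=> rho01 s0 LE; have /andP[rho0 rho1] := rho01.
rewrite (integral_has_Lambda_law (g := fun x => (x `^ s)%:E) rho01 LE)//;
  last 2 first.
- exact/measurable_EFinP.
- by move=> x; rewrite lee_fin powR_ge0.
under eq_integral do rewrite -powRrM.
rewrite integral_uniform_powR ?mulr_gt0 ?invr_gt0// powR1 -!EFinM -EFinD.
congr (_%:E); field.
by rewrite !gt_eqF//= ?addr_gt0// mulr_gt0.
Qed.

(** * Expectations and tails of products of independent variables *)

(** Factorisation on rectangles identifies the joint law with the product of the marginals, and
    Tonelli's theorem separates the integrals. *)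
Lemma ge0_integralM_independent (R : realType) (d : measure_display)
    (T : measurableType d) (P : probability T R) (f g : T -> R) :
  measurable_fun setT f -> measurable_fun setT g ->
  (forall w, 0 <= f w) -> (forall w, 0 <= g w) ->
  (forall A B : set R, measurable A -> measurable B ->
     P (f @^-1` A `&` g @^-1` B) = (P (f @^-1` A) * P (g @^-1` B))%E) ->
  (\int[P]_w (f w * g w)%:E = (\int[P]_w (f w)%:E) * \int[P]_w (g w)%:E)%E.
Proof.
move=> mf mg f0 g0 fg.
pose F : {mfun T >-> R} := mfun_Sub (mem_set mf).
pose G : {mfun T >-> R} := mfun_Sub (mem_set mg).
have mfg : measurable_fun setT (fun w => (f w, g w)) by exact: measurable_fun_pair.
pose H : {mfun T >-> (R * R)%type} := mfun_Sub (mem_set mfg).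
(* The absolute values make the integrand nonnegative on the whole plane, as Tonelli requires, and
   leave [f] and [g] unchanged. *)
pose h (z : R * R) : \bar R := (`|z.1| * `|z.2|)%:E.
have mh : measurable_fun setT h.
  apply/measurable_EFinP; apply: measurable_funM;
    by apply: (measurableT_comp (@normr_measurable R setT)).
transitivity (\int[distribution P H]_z h z)%E.
  rewrite ge0_integral_distribution//; last by move=> z; rewrite lee_fin mulr_ge0.
  by apply: eq_integral => w _; rewrite /= /h/= !ger0_norm.
rewrite (eq_measure_integral (distribution P F \x distribution P G)%E); last first.
  move=> A mA _; exact/esym/product_measure_unique.
rewrite fubini_tonelli1//; last by move=> z; rewrite lee_fin mulr_ge0.
have mn : measurable_fun setT (fun x : R => (`|x|)%:E).
  by apply/measurable_EFinP; exact: normr_measurable.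
rewrite /fubini_F /h/=.
under eq_integral => x _.
  under eq_integral do rewrite EFinM.
  rewrite ge0_integralZl_EFin//.
  over.
rewrite ge0_integralZr//; last by apply: integral_ge0 => y _; rewrite lee_fin.
rewrite !ge0_integral_distribution//.
congr (_ * _)%E; apply: eq_integral => w _; rewrite /= ger0_norm//.
Qed.

Section IndependentProducts.
Context {R : realType} {d d' : measure_display} {T : measurableType d}
  {E : measurableType d'}.
Variables (P : probability T R) (X : nat -> T -> E).
Hypothesis mX : forall n, measurable_fun setT (X n).
Hypothesis indX : mutually_independent P X.
Variables (g : E -> R) (r : R).
Hypothesis mg : measurable_fun setT g.
Hypothesis g0 : forall x, 0 <= g x.
Hypothesis gr : forall n, (\int[P]_w (g (X n w))%:E = r%:E)%E.

Let prods n k (w : T) : R := \prod_(i < k) g (X (n + i) w).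

Let mprods_coord n k : @measurable_fun _ _
  (g_sigma_algebraType (cylinder X [set j | (j < n + k)%N])) R setT (prods n k).
Proof.
rewrite /prods; apply: (@measurable_prod _ (g_sigma_algebraType _)) => i _.
apply: (@measurableT_comp _ _ _ (g_sigma_algebraType _)) => //.
by apply: measurable_coord => /=; rewrite ltn_add2l.
Qed.

Lemma measurable_prod_coord n k : measurable_fun setT (prods n k).
Proof.
apply: measurable_prod => i _; exact: measurableT_comp.
Qed.

Lemma integral_prod_independent n k :
  (\int[P]_w (\prod_(i < k) g (X (n + i) w))%:E = (r ^+ k)%:E)%E.
Proof.
elim: k => [|k IH].
  under eq_integral do rewrite big_ord0.
  by rewrite integral_cst// mul1e expr0; exact: (probability_setT P).
under eq_integral do rewrite big_ord_recr/=.
rewrite (ge0_integralM_independent (f := prods n k) (g := fun w => g (X (n + k) w))).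
- by rewrite IH gr -EFinM exprSr.
- exact: measurable_prod_coord.
- exact: measurableT_comp.
- by move=> w; apply: prodr_ge0 => i _.
- by move=> w.
- move=> A B mA mB.
  apply: (sigma_coord_independent mX indX (I1 := [set j | (j < n + k)%N])
    (I2 := [set (n + k)%N])).
  + by move=> j /= /[swap] ->; rewrite ltnn.
  + rewrite -[X in sigma_coord _ _ X]setTI.
    exact: (@mprods_coord n k (@measurableT _ (g_sigma_algebraType _)) _ mA).
  + rewrite -[X in sigma_coord _ _ X]setTI.
    apply: (_ : @measurable_fun _ _ (g_sigma_algebraType _) R setT
      (fun w => g (X (n + k) w))) => //.
    apply: (@measurableT_comp _ _ _ (g_sigma_algebraType _)) => //.
    exact: measurable_coord.
Qed.

Lemma sigma_coord_prod n k a :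
  sigma_coord X [set j | (n <= j < n + k)%N]
    [set w | a < \prod_(i < k) g (X (n + i) w)].
Proof.
have mp : @measurable_fun _ _
    (g_sigma_algebraType (cylinder X [set j | (n <= j < n + k)%N])) R setT
    (prods n k).
  rewrite /prods; apply: (@measurable_prod _ (g_sigma_algebraType _)) => i _.
  apply: (@measurableT_comp _ _ _ (g_sigma_algebraType _)) => //.
  by apply: measurable_coord => /=; rewrite ltn_add2l leq_addr /=.
have := mp measurableT `]a, +oo[%classic (measurable_itv _).
by rewrite setTI; congr sigma_coord; apply/seteqP; split=> w /=;
  rewrite in_itv/= andbT.
Qed.

(** Markov's inequality; when [g] is an exponential this is Chernoff's bound for a sum. *)
Lemma prod_markov n k a : 0 < a ->
  (P [set w | (a < \prod_(i < k) g (X (n + i) w))%R] <= (a^-1 * r ^+ k)%:E)%E.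
Proof.
move=> a0; set A := [set w | _].
have mA : measurable A by exact: sigma_coord_measurable (@sigma_coord_prod n k a).
rewrite EFinM lee_pdivlMl// -(integral_prod_independent n).
rewrite -[A in P A]setIT -integral_indic// -ge0_integralZl_EFin ?(ltW a0)//.
  2: by apply/measurable_EFinP; exact: measurable_indic.
apply: ge0_le_integral => //.
- by move=> w _; rewrite mule_ge0// lee_fin ltW.
- by apply: measurable_funeM; exact/measurable_EFinP/measurable_indic.
- by apply/measurable_EFinP; exact: measurable_prod_coord.
- move=> w _; rewrite indicE; case: (boolP (w \in A)).
    by rewrite inE => /= h; rewrite mule1 lee_fin ltW.
  by rewrite mule0 lee_fin prodr_ge0.
Qed.

End IndependentProducts.

(** * From the characteristic function of a stable law to its tail *)

Lemma onem_cos_le (R : realType) (x : R) : 1 - cos x <= `|x|.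
Proof.
wlog x0 : x / 0 <= x.
  move=> h; have [|x0] := leP 0 x; first exact: h.
  by rewrite -cosN -normrN; apply: h; rewrite oppr_ge0 ltW.
have [|c _] := @MVT_segment R (@cos R) (fun x => - sin x) 0 x x0 _.
  by apply: continuous_subspaceT => y; exact: continuous_cos.
rewrite cos0 subr0 => h; rewrite -opprB h ger0_norm// mulNr opprK.
by rewrite ler_piMl// sin_le1.
Qed.

(** With [u = t^alpha <= 1], the real part is [exp(-u cos phi) cos(u sin phi)]; the exponential lies
    between [1 - u] and [e], and the cosine is within [u] of 1. *)
Lemma stable_char_fun_Re_ge (R : realType) (alpha rho t : R) :
  0 < alpha -> 0 < t <= 1 ->
  1 - (1 + expR 1) * t `^ alpha <= complex.Re (stable_char_fun alpha rho t).
Proof.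
move=> alpha0 /andP[t0 t1]; rewrite /stable_char_fun (ltW t0) (ger0_norm (ltW t0)).
set phi := - (pi * alpha / 2 * (2 * rho - 1) * 1).
set u := t `^ alpha.
have u0 : 0 <= u by exact: powR_ge0.
have u1 : u <= 1.
  rewrite (_ : 1 = 1 `^ alpha); last by rewrite powR1.
  by rewrite ge0_ler_powR// ?nnegrE ltW.
have -> : complex.Re (cexp (- (u%:C * cexp (0 +i* phi)))%C) =
    expR (- (u * cos phi)) * cos (u * sin phi).
  by rewrite /= expR0 !mul1r !mul0r subr0 addr0 (cosN (u * _)).
have e0 := expR_gt0 (- (u * cos phi)).
have h1 : 1 - u <= expR (- (u * cos phi)).
  apply: le_trans (expR_ge1Dx _); rewrite lerD2l lerN2.
  by rewrite ler_piMr// cos_le1.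
have h2 : expR (- (u * cos phi)) <= expR 1.
  rewrite ler_expR -mulrN; apply: (@le_trans _ _ (u * 1)).
    by rewrite ler_wpM2l// lerNl cos_geN1.
  by rewrite mulr1.
have h3 : 1 - cos (u * sin phi) <= u.
  apply: le_trans (onem_cos_le _) _; rewrite normrM ger0_norm//.
  by rewrite ler_piMr// sin_max.
have h4 : expR (- (u * cos phi)) * (1 - cos (u * sin phi)) <= expR 1 * u.
  by apply: ler_pM => //; rewrite subr_ge0 cos_le1.
move: h4; rewrite mulrBr mulr1; lra.
Qed.

(** [1 - Re E exp(i t Y)] is the mean of the nonnegative variable [1 - cos(t Y)], which is at least
    [1 - k] on [A]. *)
Lemma prob_le_onem_char_fun (R : realType) (d : measure_display)
    (T : measurableType d) (P : probability T R) (Y : {RV P >-> R})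
    (t k : R) (A : set T) :
  measurable A -> k < 1 -> (forall w, A w -> cos (t * Y w) <= k) ->
  (P A <= ((1 - complex.Re (char_fun P Y t)) / (1 - k))%:E)%E.
Proof.
move=> mA k1 hA.
have mc : measurable_fun setT (fun w => cos (t * Y w)).
  apply: measurableT_comp.
    by apply: continuous_measurable_fun; exact: continuous_cos.
  by apply: measurable_funM.
have ic : P.-integrable setT (fun w => (cos (t * Y w))%:E).
  apply: (measurable_bounded_integrable measurableT _ mc).
    by rewrite -ge0_fin_numE// fin_num_measure.
  exists 1; split=> // M M1 w _ /=.
  exact: le_trans (cos_max _) (ltW M1).
have Ec : (\int[P]_w (1 - cos (t * Y w))%:E =
    (1 - complex.Re (char_fun P Y t))%:E)%E.
  rewrite /= (_ : 'E_P[_] = \int[P]_w (cos (t * Y w))%:E)%E; last by rewrite unlock.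
  rewrite EFinB fineK; last exact: integrable_fin_num.
  under eq_integral do rewrite EFinB.
  rewrite integralB_EFin//; last exact: finite_measure_integrable_cst.
  by rewrite integral_cst// mul1e; congr (_ - _)%E; exact: (probability_setT P).
rewrite EFinM lee_pdivlMr ?subr_gt0// -Ec muleC.
have {1}-> : P A = (\int[P]_w (\1_A w)%:E)%E by rewrite integral_indic// setIT.
rewrite -ge0_integralZl_EFin ?subr_ge0 ?(ltW k1)//.
  2: by apply/measurable_EFinP; exact: measurable_indic.
apply: ge0_le_integral => //.
- by move=> w _; rewrite mule_ge0// lee_fin subr_ge0 ltW.
- by apply: measurable_funeM; exact/measurable_EFinP/measurable_indic.
- by apply/measurable_EFinP; exact: measurable_funB.
- move=> w _; rewrite indicE; case: (boolP (w \in A)).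
    by rewrite inE => /hA h; rewrite mule1 lee_fin lerD2l lerN2.
  by rewrite mule0 lee_fin subr_ge0 cos_le1.
Qed.

(** The tail event is cut into geometric shells, and each shell is tested with a frequency [t]
    inverse to its outer radius. Then [t^alpha = q^(i+1)], so the shell probabilities sum
    geometrically. *)
Lemma stable_tail (R : realType) (d : measure_display)
    (T : measurableType d) (P : probability T R) (Y : {RV P >-> R})
    (alpha rho dlt : R) :
  0 < alpha -> 0 < dlt ->
  (forall t, char_fun P Y t = stable_char_fun alpha rho t) ->
  exists2 K, 0 <= K & forall j : nat,
    (P [set w | (expR (dlt * j%:R) < Y w)%R] <=
      (K * expR (- (dlt * alpha)) ^+ j)%:E)%E.
Proof.
move=> alpha0 dlt0 hchar.
set q := expR (- (dlt * alpha)).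
have q0 : 0 <= q by exact: expR_ge0.
have q1 : q < 1 by rewrite expR_lt1 oppr_lt0 mulr_gt0.
pose k := cos (expR (- dlt) : R).
have ed1 : expR (- dlt) < 1 by rewrite expR_lt1 oppr_lt0.
have itv01 (x : R) : 0 <= x <= 1 -> x \in `[0, pi]%R.
  move=> /andP[x0 x1]; rewrite in_itv/= x0 (le_trans x1)//.
  by rewrite (le_trans _ (pi_ge2 R))// ler1n.
have i0 : (0 : R) \in `[0, pi]%R by rewrite itv01// lexx ler01.
have ie : expR (- dlt) \in `[0, pi]%R by rewrite itv01// expR_ge0 ltW.
have k1 : k < 1 by rewrite -(cos0 R) ltr_cos// expR_gt0.
(* On the shell [A i] the choice [t = exp (- dlt (i+1))] puts [t Y] between
   [exp (- dlt)] and [1], where [cos] stays below [k]. *)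
pose A i : set T := [set w | expR (dlt * i%:R) < Y w <= expR (dlt * i.+1%:R)].
have mA i : measurable (A i).
  rewrite (_ : A i = Y @^-1` `]expR (dlt * i%:R), expR (dlt * i.+1%:R)]%classic).
    by rewrite -[X in measurable X]setTI; apply: measurable_funP.
  by apply/seteqP; split=> w /=; rewrite in_itv.
pose C := (1 + expR 1) * q / (1 - k).
have C0 : 0 <= C.
  apply: divr_ge0; last by rewrite subr_ge0 ltW.
  by apply: mulr_ge0 => //; apply: addr_ge0 => //; exact: expR_ge0.
have PA i : (P (A i) <= (C * q ^+ i)%:E)%E.
  pose t : R := expR (- (dlt * i.+1%:R)).
  have t01 : 0 < t <= 1.
    by rewrite expR_gt0 expR_le1 oppr_le0 mulr_ge0// ltW.
  apply: (le_trans (@prob_le_onem_char_fun _ _ _ _ Y t k (A i) (mA i) k1 _)).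
    move=> w /andP[Yl Yu].
    have Y0 : 0 < Y w by exact: lt_trans (expR_gt0 _) Yl.
    have tY : expR (- dlt) <= t * Y w.
      rewrite (_ : - dlt = - (dlt * i.+1%:R) + dlt * i%:R).
        by rewrite expRD ler_wpM2l ?expR_ge0// ltW.
      by rewrite -natr1; ring.
    have tY1 : t * Y w <= 1.
      apply: (@le_trans _ _ (t * expR (dlt * i.+1%:R))).
        by rewrite ler_wpM2l ?expR_ge0.
      by rewrite /t -expRD addNr expR0.
    rewrite /k le_eqVlt; move: tY; rewrite le_eqVlt => /predU1P[->|tY].
      by rewrite eqxx.
    by rewrite ltr_cos// ?tY ?orbT// itv01// tY1 mulr_ge0 ?expR_ge0// ltW.
  rewrite lee_fin hchar /C mulrAC ler_wpM2r//.
    by rewrite invr_ge0 subr_ge0 ltW.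
  rewrite lerBlDr -lerBlDl.
  apply: le_trans (stable_char_fun_Re_ge rho alpha0 t01).
  rewrite (_ : t `^ alpha = q * q ^+ i)// ?mulrA//.
  rewrite -exprS /powR gt_eqF ?expR_gt0// expRK /q -expRM_natr.
  by congr expR; ring.
exists (C / (1 - q)); first by rewrite divr_ge0// subr_ge0 ltW.
move=> j; rewrite mulrAC.
apply: (measure_union_geometric _ _ (A := fun i => A (i + j)%N)).
- by rewrite mulr_ge0// exprn_ge0.
- by rewrite q0.
- by move=> i; exact: mA.
- rewrite (_ : [set w | _] = Y @^-1` `]expR (dlt * j%:R), +oo[%classic).
    by rewrite -[X in measurable X]setTI; apply: measurable_funP.
  by apply/seteqP; split=> w /=; rewrite in_itv/= andbT.
- by move=> i; rewrite -mulrA -exprD addnC; exact: PA.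
- move=> w /= Yw.
  have Y0 : 0 < Y w by exact: lt_trans (expR_gt0 _) Yw.
  (* The least such [i] puts [w] in the shell [A (i + j)]: the lower bound comes from minimality if
     [i > 0] and from [Yw] if [i = 0]. *)
  have ex : exists i, Y w <= expR (dlt * (i + j).+1%:R).
    exists (Num.bound `|ln (Y w) / dlt|).
    rewrite -[leLHS]lnK ?posrE// ler_expR mulrC -ler_pdivrMr//.
    apply: le_trans (ler_norm _) _.
    apply: le_trans (ltW (archi_boundP (normr_ge0 _))) _.
    by rewrite ler_nat leqW// leq_addr.
  have [i Yi imin] := ex_minnP ex.
  exists i => //; rewrite /A/= Yi andbT.
  case: i imin {Yi} => [//|i imin].
  by rewrite ltNge; apply/negP => /imin; rewrite ltnn.
Qed.

(** * Measurability of the processes *)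

Lemma measurable_expeR (R : realType) : measurable_fun setT (@expeR R).
Proof.
rewrite (_ : @expeR R = fun x => if (x == +oo)%E then +oo%E else
    if (x == -oo)%E then 0%E else (expR (fine x))%:E); last first.
  by apply/funext => -[].
apply: measurable_fun_ifT => //; first exact: measurable_fun_eqe.
apply: measurable_fun_ifT => //; first exact: measurable_fun_eqe.
by apply/measurable_EFinP; apply: measurableT_comp.
Qed.

Section CountableExtrema.
Context {R : realType} {d : measure_display} {T : measurableType d}.

Lemma measurable_ereal_sup_range (f : nat -> T -> \bar R) :
  (forall j, measurable_fun setT (f j)) ->
  measurable_fun setT (fun w => ereal_sup (range (f ^~ w))).
Proof.
move=> mf; have := measurable_fun_esups mf 0.
by apply: eq_measurable_fun => w _; rewrite /esups /=; congr ereal_sup;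
  apply/seteqP; split=> [_ [j _ <-]|_ [j _ <-]]; exists j.
Qed.

Lemma measurable_ereal_inf_cond (b : nat -> T -> bool) (c : nat -> \bar R) :
  (forall j, measurable_fun setT (b j)) ->
  measurable_fun setT (fun w => ereal_inf [set c j | j in [set j | b j w]]).
Proof.
(* Excluded indices get the value [+oo], which turns the random index set into a fixed one. *)
move=> mb; pose f j w := if b j w then c j else +oo%E.
have mf j : measurable_fun setT (f j) by exact: measurable_fun_ifT.
have := measurable_fun_einfs mf 0.
apply: eq_measurable_fun => w _; rewrite /einfs /=.
apply/eqP; rewrite eq_le; apply/andP; split.
  apply: le_ereal_inf => _ [j /= bj <-]; exists j => //.
  by rewrite /f bj.
apply: le_ereal_inf_tmp => _ [j _ <-]; rewrite /f; case: ifPn => bj.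
  by apply: ereal_inf_lbound; exists j.
by rewrite leey.
Qed.

End CountableExtrema.

Lemma esum_int_le (R : realType) (n : int) (a : int -> \bar R) :
  (forall k, (0 <= a k)%E) ->
  (\esum_(k in [set k : int | (k <= n)%R]) a k =
   \sum_(0 <= j <oo) a (n - j%:Z)%R)%E.
Proof.
move=> a0; rewrite (@reindex_esum _ _ _ [set: nat] _ (fun j : nat => n - j%:Z)).
  by rewrite nneseries_esumT.
split.
- by move=> j _ /=; lia.
- by move=> i j _ _ /= h; lia.
- by move=> k /= kn; exists (absz (n - k)) => //; lia.
Qed.

Section Coordinates.
Context {R : realType}.

Lemma measurable_s_ : measurable_fun setT (@s_ R).
Proof.
apply: measurableT_comp measurable_fst _.
exact: measurableT_comp measurable_fst measurable_fst.
Qed.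

Lemma measurable_u_ : measurable_fun setT (@u_ R).
Proof.
apply: measurableT_comp measurable_snd _.
exact: measurableT_comp measurable_fst measurable_fst.
Qed.

Lemma measurable_lambda_ : measurable_fun setT (@lambda_ R).
Proof. exact: measurable_snd. Qed.

(** The inverse of [u] is written as the power [-1], a measurable function on the whole line that
    agrees with the inverse for [u > 0]. *)
Lemma a_measurable_on_calA (alpha : R) :
  exists2 f, measurable_fun setT f & forall x, calA x -> a_ alpha x = f x.
Proof.
exists (fun x => (lambda_ x `^ (- alpha^-1) - 1) *
    ((1 - u_ x) * u_ x `^ (-1)) `^ alpha^-1 * s_ x).
  have ml := measurable_lambda_; have mu := measurable_u_.
  apply: measurable_funM; last exact: measurable_s_.
  apply: measurable_funM.
    by apply: measurable_funB => //; apply: (measurableT_comp (measurable_powR _)).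
  apply: (measurableT_comp (measurable_powR _)).
  apply: measurable_funM; first exact: measurable_funB.
  exact: (measurableT_comp (measurable_powR _)).
by move=> x [_ /andP[/ltW u0 _] _ _]; rewrite powR_inv1.
Qed.

End Coordinates.

Section Measurability.
Context {R : realType} {d0 : measure_display} {T : measurableType d0}.
Variables (alpha dlt d : R) (X : int -> T -> R * R * R * R).
Hypothesis mX : forall n, measurable_fun setT (X n).
Hypothesis XA : forall n w, calA (X n w).

Let ms n : measurable_fun setT (fun w => s_ (X n w)).
Proof. exact: measurableT_comp measurable_s_ (mX n). Qed.

Let mu n : measurable_fun setT (fun w => u_ (X n w)).
Proof. exact: measurableT_comp measurable_u_ (mX n). Qed.

Let ml n : measurable_fun setT (fun w => lambda_ (X n w)).
Proof. exact: measurableT_comp measurable_lambda_ (mX n). Qed.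

Lemma measurable_a_ n : measurable_fun setT (fun w => a_ alpha (X n w)).
Proof.
have [f mf fE] := a_measurable_on_calA alpha.
rewrite (_ : (fun w => _) = f \o X n); first exact: measurableT_comp mf (mX n).
by apply/funext => w; rewrite /= fE.
Qed.

Lemma measurable_F_ n : measurable_fun setT (fun w => F_ alpha d (X^~ w) n).
Proof.
rewrite /F_; apply: measurable_funD => //; apply: measurable_funM => //.
by apply: (measurableT_comp (@measurable_ln R)); exact: measurable_funM.
Qed.

Lemma measurable_C_ n : measurable_fun setT (fun w => C_ alpha d (X^~ w) n).
Proof.
case: n => m /=; last by apply: measurable_sum => i; exact: measurable_F_.
apply: measurableT_comp => //; apply: measurable_sum => i; exact: measurable_F_.
Qed.

Lemma measurable_R_ n : measurable_fun setT (fun w => R_ alpha d (X^~ w) n).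
Proof.
apply: emeasurable_funB; last by apply/measurable_EFinP; exact: measurable_C_.
have := @measurable_ereal_sup_range R _ T
  (fun j w => (C_ alpha d (X^~ w) (n - j%:Z))%:E).
have mC j : measurable_fun setT (fun w => (C_ alpha d (X^~ w) (n - j%:Z))%:E).
  by apply/measurable_EFinP; exact: measurable_C_.
move=> /(_ mC); apply: eq_measurable_fun => w _; congr ereal_sup.
apply/seteqP; split=> [_ [j _ <-]|_ [k /= kn <-]].
  by exists (n - j%:Z) => //=; lia.
exists (absz (n - k)%R) => //; congr (C_ _ _ _ _)%:E; lia.
Qed.

Lemma measurable_chi_ n : measurable_fun setT (fun w => chi_ dlt (X^~ w) n).
Proof.
rewrite /chi_; apply: measurable_mine => //.
pose k_ (j : nat) : int := n - 1 - j%:Z.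
have := @measurable_ereal_inf_cond R _ T
  (fun j w => I_ dlt (X^~ w) n (k_ j)) (fun j => ((k_ j)%:~R : R)%:E).
have mI j : measurable_fun setT (fun w => I_ dlt (X^~ w) n (k_ j)).
  by rewrite /I_; apply: measurable_fun_ltr.
move=> /(_ mI); apply: eq_measurable_fun => w _; congr ereal_inf.
apply/seteqP; split=> [_ [j /= Ij <-]|_ [k /= [kn Ik] <-]].
  by exists (k_ j) => //=; split=> //; rewrite /k_; lia.
have kE : k_ (absz (n - 1 - k)%R) = k by rewrite /k_; lia.
by exists (absz (n - 1 - k)%R) => /=; rewrite kE.
Qed.

Let wt n k w : R := expR (- (n - 1 - k)%:~R * d) * s_ (X k w).

Let wt_ge0 n k w : 0 <= wt n k w.
Proof. by rewrite mulr_ge0 ?expR_ge0//; case: (XA k w) => /ltW. Qed.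

Let mwt n k : measurable_fun setT (wt n k).
Proof. exact: measurable_funM. Qed.

Lemma measurable_D''_ n : measurable_fun setT (fun w => D''_ d (X^~ w) n).
Proof.
have -> : (fun w => D''_ d (X^~ w) n) =
    (fun w => \sum_(0 <= j <oo) (wt n (n - 1 - j%:Z) w)%:E)%E.
  apply/funext => w; rewrite /D''_ esum_int_le// => k.
  by rewrite lee_fin; exact: wt_ge0.
apply: ge0_emeasurable_sum => [j w _ _|j _]; first by rewrite lee_fin wt_ge0.
exact/measurable_EFinP.
Qed.

Lemma measurable_D'_ n : measurable_fun setT (fun w => D'_ alpha dlt d (X^~ w) n).
Proof.
apply: emeasurable_funM.
  by apply: (measurableT_comp (@measurable_expeR R)); exact: measurable_R_.
by apply: emeasurable_funD => //; exact: measurable_D''_.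
Qed.

Lemma measurable_D_ n : measurable_fun setT (fun w => D_ alpha dlt d (X^~ w) n).
Proof.
apply: emeasurable_funM.
  by apply: (measurableT_comp (@measurable_expeR R)); exact: measurable_R_.
apply: emeasurable_funD.
  apply: emeasurable_funM => //.
  apply: (measurableT_comp (@measurable_expeR R)).
  by apply: measurable_funeM; apply: emeasurable_funB => //; exact: measurable_chi_.
pose v k w : \bar R := (wt n k w * (1 - u_ (X k w)) `^ alpha^-1)%:E.
(* The random lower end [chi_n] of the sum is moved into the summand. *)
pose v' k w : \bar R := if (chi_ dlt (X^~ w) n <= k%:~R%:E)%E then v k w else 0%E.
have v'0 k w : (0 <= v' k w)%E.
  by rewrite /v'; case: ifP => // _; rewrite lee_fin mulr_ge0// ?powR_ge0.
have mv' k : measurable_fun setT (v' k).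
  apply: measurable_fun_ifT => //.
    by apply: measurable_fun_lee => //; exact: measurable_chi_.
  apply/measurable_EFinP; apply: measurable_funM => //.
  by apply: (measurableT_comp (measurable_powR _)); exact: measurable_funB.
rewrite (_ : (fun w => _) = (fun w => \sum_(0 <= j <oo) v' (n - 1 - j%:Z)%R w)%E).
  by apply: ge0_emeasurable_sum.
apply/funext => w.
rewrite -(@esum_int_le _ (n - 1) (v' ^~ w))//.
rewrite (_ : [set k : int | _] = [set k : int | (k <= n - 1)%R] `&`
  [set k : int | (chi_ dlt (X^~ w) n <= k%:~R%:E)%E]); last first.
  by apply/seteqP; split=> k [].
rewrite esum_mkcondr; apply: eq_esum => k _.
rewrite /v'; case: ifPn; first by rewrite inE /= => ->.
by rewrite notin_setE /= => /negP/negbTE ->.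
Qed.

Lemma measurable_sigma_ :
  measurable_fun setT (fun w => sigma_ alpha dlt d (X^~ w)).
Proof.
have := @measurable_ereal_inf_cond R _ T
  (fun j w => (0 < j)%N && (D_ alpha dlt d (X^~ w) (- j%:Z) <=
     (a_ alpha (X (- j%:Z) w))%:E)%E) (fun j => (j%:R : R)%:E).
have mb j : measurable_fun setT (fun w => (0 < j)%N &&
    (D_ alpha dlt d (X^~ w) (- j%:Z) <= (a_ alpha (X (- j%:Z) w))%:E)%E).
  apply: measurable_and => //; apply: measurable_fun_lee; first exact: measurable_D_.
  by apply/measurable_EFinP; exact: measurable_a_.
move=> /(_ mb); apply: eq_measurable_fun => w _; congr ereal_inf.
by apply/seteqP; split=> [_ [j /= /andP[j0 jD] <-]|_ [j /= [j0 jD] <-]];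
  exists j => //; apply/andP.
Qed.

Lemma measurable_Xi_ n : measurable_fun setT (fun w => Xi_ alpha dlt d (X^~ w) n).
Proof.
apply: measurable_fun_pair; last exact: measurable_D'_.
by apply: measurable_fun_pair; last exact: measurable_R_.
Qed.

End Measurability.

(** * Bounds for D along a path *)

Section PathBounds.
Context {R : realType}.
Variables (alpha dlt d : R) (x : int -> R * R * R * R).
Hypothesis alpha0 : 0 < alpha.
Hypothesis dltd : dlt < d.
Hypothesis xA : forall n, calA (x n).

Lemma C_sub (n : int) (k : nat) :
  C_ alpha d x (n - k%:Z) = C_ alpha d x n + \sum_(i < k) F_ alpha d x (n - i.+1%:Z).
Proof.
elim: k => [|k IH]; first by rewrite big_ord0 !addr0.
rewrite big_ord_recr/= addrA -IH.
have -> : n - k%:Z = (n - k.+1%:Z) + 1 by lia.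
by rewrite C_succ subrK.
Qed.

(** [C_(n-k) - C_n] is the sum [F_(n-1) + .. + F_(n-k)]; the condition [0 <= M] covers the empty sum
    [k = 0]. *)
Lemma R_le (n : int) (M : R) : 0 <= M ->
  (forall k, \sum_(i < k.+1) F_ alpha d x (n - i.+1%:Z) <= M) ->
  (R_ alpha d x n <= M%:E)%E.
Proof.
move=> M0 hF; rewrite /R_ leeBlDr//.
apply: ge_ereal_sup => _ [k /= kn <-].
have -> : k = n - (absz (n - k)%R)%:Z by lia.
rewrite C_sub -EFinD lee_fin addrC lerD2r.
by case: (absz _) => [|j]; [rewrite big_ord0|exact: hF].
Qed.

(* The factor [exp ((d - dlt) (chi_n - n))] is at most [1] because [chi_n < n],
   so [chi_n] plays no role in the upper bound. *)
Lemma D_le_D' (n : int) : (D_ alpha dlt d x n <= D'_ alpha dlt d x n)%E.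
Proof.
have g0 : 0 < 1 - expR (dlt - d) by rewrite subr_gt0 expR_lt1 subr_lt0.
have wt0 k : 0 <= expR (- (n - 1 - k)%:~R * d) * s_ (x k).
  by rewrite mulr_ge0 ?expR_ge0//; case: (xA k) => /ltW.
apply: lee_wpmul2l; first exact: expeR_ge0.
apply: leeD.
  rewrite -[leRHS]mul1e lee_wpmul2r ?lee_fin ?invr_ge0 ?(ltW g0)//.
  rewrite -expeR0 lee_expeR; apply: mule_ge0_le0.
    by rewrite lee_fin subr_ge0 ltW.
  rewrite leeBlDr// add0e; apply: (@le_trans _ _ ((n - 1)%:~R)%:E).
    by rewrite /chi_ ge_min lexx.
  by rewrite lee_fin ler_int; lia.
apply: (@le_trans _ _ (\esum_(k in [set k : int |
    (chi_ dlt x n <= k%:~R%:E)%E /\ (k <= n - 1)%R])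
    (expR (- (n - 1 - k)%:~R * d) * s_ (x k))%:E)%E).
  apply: le_esum => k _; rewrite lee_fin ler_piMr//.
  have [_ /andP[u0 u1] _ _] := xA k.
  apply: (@le_trans _ _ (1 `^ alpha^-1)); last by rewrite powR1.
  rewrite ge0_ler_powR// ?invr_ge0 ?(ltW alpha0)// ?nnegrE ?subr_ge0 ?(ltW u1)//.
  by rewrite gerBl ltW.
rewrite /D''_ [leRHS]esum_mkcond esum_mkcond.
apply: le_esum => k _; case: ifPn => [|_]; last first.
  by case: ifPn => // _; rewrite lee_fin.
by rewrite inE => -[_ kn]; rewrite mem_set.
Qed.

(** The discount [exp(-k d)] beats the allowed growth [exp(dlt k)] of [S], leaving a geometric
    series of ratio [exp(dlt - d)]. *)
Lemma D''_le (n : int) (j0 : nat) :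
  (forall k : nat, s_ (x (n - k.+1%:Z)) <= expR (dlt * (k + j0)%:R)) ->
  (D''_ d x n <= (expR (dlt * j0%:R) / (1 - expR (dlt - d)))%:E)%E.
Proof.
move=> hs; rewrite /D''_ esum_int_le; last first.
  by move=> k; rewrite lee_fin mulr_ge0 ?expR_ge0//; case: (xA k) => /ltW.
rewrite -nneseries_geometric ?expR_ge0//; last by rewrite expR_lt1 subr_lt0.
apply: lee_nneseries => k _ //.
  by rewrite lee_fin mulr_ge0 ?expR_ge0//; case: (xA (n - 1 - k%:Z)) => /ltW.
have -> : n - 1 - k%:Z = n - k.+1%:Z by lia.
have -> : n - 1 - (n - k.+1%:Z) = k%:Z by lia.
rewrite lee_fin.
apply: (@le_trans _ _ (expR (- k%:R * d) * expR (dlt * (k + j0)%:R))).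
  by rewrite ler_wpM2l ?expR_ge0//; exact: hs.
rewrite -expRM_natr -!expRD ler_expR natrD; lra.
Qed.

Lemma D_bound (n : int) (M : R) (j0 : nat) : 0 <= M ->
  (forall k, \sum_(i < k.+1) F_ alpha d x (n - i.+1%:Z) <= M) ->
  (forall k : nat, s_ (x (n - k.+1%:Z)) <= expR (dlt * (k + j0)%:R)) ->
  (D_ alpha dlt d x n <=
     (expR M * ((1 + expR (dlt * j0%:R)) / (1 - expR (dlt - d))))%:E)%E.
Proof.
move=> M0 hF hs; apply: le_trans (D_le_D' n) _.
have g0 : 0 < 1 - expR (dlt - d) by rewrite subr_gt0 expR_lt1 subr_lt0.
rewrite /D'_ EFinM; apply: lee_pmul; first exact: expeR_ge0.
- apply: adde_ge0; first by rewrite lee_fin invr_ge0 ltW.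
  apply: esum_ge0 => k _.
  by rewrite lee_fin mulr_ge0 ?expR_ge0//; case: (xA k) => /ltW.
- by rewrite -[X in (_ <= X)%E]/(expeR M%:E) lee_expeR; exact: R_le.
- by rewrite mulrDl mul1r EFinD; apply: leeD => //; exact: D''_le.
Qed.

End PathBounds.

(** * The sequence Theta *)

Lemma mutually_independent_reindex (R : realType) (d d' : measure_display)
    (T : measurableType d) (E : measurableType d') (P : probability T R)
    (I J : eqType) (X : I -> T -> E) (f : J -> I) (g : I -> J) :
  cancel f g -> mutually_independent P X ->
  mutually_independent P (fun j => X (f j)).
Proof.
move=> fK indX J0 B uJ mB.
have := indX (map f J0) (fun i => B (g i)).
rewrite map_inj_uniq; last exact: can_inj fK.
move=> /(_ uJ (fun i => mB (g i))); rewrite big_map.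
under eq_bigr do rewrite fK.
move=> <-; congr (P _); apply/seteqP; split=> w /= h j jJ.
  by move/mapP : jJ => [i iJ ->]; rewrite fK; exact: h.
by have := h (f j) (map_f f jJ); rewrite fK.
Qed.

Lemma exists_exp_moment_lt1 (R : realType) (alpha rho d : R) :
  0 < alpha -> 0 < rho -> 0 < d -> d < (alpha * rho)^-1 ->
  exists2 s, 0 < s & expR (alpha * s * d) * (rho / (rho + s)) < 1.
Proof.
move=> alpha0 rho0 d0 hd.
pose b := alpha * d.
have b0 : 0 < b by rewrite mulr_gt0.
have brho : b * rho < 1.
  by move: hd; rewrite -[_^-1]mul1r ltr_pdivlMr ?mulr_gt0// /b mulrC mulrAC.
(* Since [exp(s b) <= 1 / (1 - s b)], it is enough that [rho < (1 - s b)(rho + s)], that is,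
   [s b < 1 - b rho]; the choice makes [s b] half of that bound. *)
pose s := (1 - b * rho) / (2 * b).
have s0 : 0 < s by rewrite divr_gt0 ?subr_gt0// mulr_gt0.
have sb : s * b = (1 - b * rho) / 2 by rewrite /s; field; rewrite gt_eqF.
exists s => //.
have x1 : 0 < 1 - s * b.
  by rewrite sb; have := mulr_gt0 b0 rho0; lra.
have e1 : expR (alpha * s * d) <= (1 - s * b)^-1.
  rewrite -[leLHS]invrK lef_pV2 ?posrE// ?invr_gt0 ?expR_gt0//.
  rewrite -expRN; apply: le_trans (expR_ge1Dx _).
  by rewrite lerD2l lerN2 /b; lra.
apply: (@le_lt_trans _ _ ((1 - s * b)^-1 * (rho / (rho + s)))).
  by rewrite ler_wpM2r// divr_ge0// ltW// addr_gt0.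
rewrite mulrC ltr_pdivrMr// mul1r ltr_pdivrMr ?addr_gt0//.
have : s * (s * b) < s * (1 - b * rho).
  by rewrite ltr_pM2l// sb; have := subr_gt0 (b * rho) 1; rewrite brho => h; lra.
nra.
Qed.

Lemma uniform_prob_itv0 (R : realType) (c : R) : 0 <= c <= 1 ->
  uniform_prob (@ltr01 R) `[0, c]%classic = c%:E.
Proof.
move=> /andP[c0 c1].
rewrite -[`[0, c]%classic in LHS]setIT -integral_indic//.
rewrite integral_uniform//.
- rewrite subr0 invr1 mul1e integral_indic//.
  rewrite (_ : _ `&` _ = `[0, c]%classic).
    apply: (etrans (lebesgue_measure_itv `[0, c])); rewrite /= lte_fin.
    case: ltgtP c0 => // [c0 _|<- _].
      by rewrite oppr0 adde0.
    by [].
  rewrite setIidl// => x /=; rewrite !in_itv/= => /andP[-> /le_trans]; exact.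
- by apply/measurable_EFinP; exact: measurable_indic.
Qed.

Lemma prob_bigcup_gt0 (R : realType) (d : measure_display)
    (T : measurableType d) (P : probability T R) (A : nat -> set T) :
  (forall n, measurable (A n)) -> \bigcup_n A n = setT ->
  exists n, (0 < P (A n))%E.
Proof.
move=> mA AT; apply: contrapT => h.
have A0 n : P (A n) = 0%E.
  apply/eqP; apply: contrapT => /negP nz; apply: h; exists n.
  by rewrite lt0e nz measure_ge0.
have : (P setT <= \sum_(0 <= n <oo) P (A n))%E.
  by apply: measure_sigma_subadditive => //; rewrite AT.
rewrite eseries0; last by move=> n _ _; exact: A0.
have -> : P setT = 1%E by exact: probability_setT.
by rewrite lee_fin ler10.
Qed.

(** * The mean of sigma for the sequence Theta *)

Section Model.
Context {R : realType} {d1 d2 : measure_display} {T1 : measurableType d1}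
  {T : measurableType d2}.
Variables (alpha rho dlt d : R).
Hypothesis alpha0 : 0 < alpha.
Hypothesis rho01 : 0 < rho < 1.
Hypothesis dlt0 : 0 < dlt.
Hypothesis dltd : dlt < d.
Hypothesis hd : d < (alpha * rho)^-1.
Variables (P1 : probability T1 R) (Y : {RV P1 >-> R}).
Hypothesis hpos : P1 [set w | 0 < Y w] = rho%:E.
Hypothesis hchar : forall t, char_fun P1 Y t = stable_char_fun alpha rho t.
Variables (P : probability T R) (S U W L : int -> {RV P >-> R}).
Hypothesis hTheta : Theta_sequence P1 Y rho S U W L.

Let Theta := Theta_ S U W L.

Lemma measurable_Theta n : measurable_fun setT (Theta n).
Proof. by do 3! (apply: measurable_fun_pair => //). Qed.

Lemma Theta_calA n w : calA (Theta n w).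
Proof. by case: hTheta => _ + _ _; apply. Qed.

(** Time is reversed, so that the past of time [-n], on which [D_(-n)] depends, consists of the
    coordinates with index greater than [n]. *)
Let X (n : nat) (w : T) := Theta (- n%:Z) w.

Let mX n : measurable_fun setT (X n).
Proof. exact: measurable_Theta. Qed.

Let indX : mutually_independent P X.
Proof.
have [[indT _] _ _ _] := hTheta.
apply: (mutually_independent_reindex (f := fun n : nat => - n%:Z) (g := absz)) indT.
by move=> n; rewrite abszN.
Qed.

Let idX n B : measurable B -> P (X n @^-1` B) = P (X 0 @^-1` B).
Proof. by move=> mB; have [[_ idT] _ _ _] := hTheta; exact: idT. Qed.

Lemma component_independent n (A B D C : set R) :
  measurable A -> measurable B -> measurable D -> measurable C ->
  P (S n @^-1` A `&` U n @^-1` B `&` W n @^-1` D `&` L n @^-1` C) =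
  (P (S n @^-1` A) * P (U n @^-1` B) * P (W n @^-1` D) * P (L n @^-1` C))%E.
Proof.
move=> mA mB mD mC; have [_ _ ind4 _] := hTheta.
pose F (i : 'I_4) : set R := nth setT [:: A; B; D; C] i.
have mF i : measurable (F i).
  by rewrite /F; case: i => -[|[|[|[|]]]].
pose i0 : 'I_4 := @Ordinal 4 0 isT.
pose i1 : 'I_4 := @Ordinal 4 1 isT.
pose i2 : 'I_4 := @Ordinal 4 2 isT.
pose i3 : 'I_4 := @Ordinal 4 3 isT.
have := ind4 n [:: i0; i1; i2; i3] F isT mF.
rewrite !big_cons big_nil mulr1 !EFinM.
have fE (V : {RV P >-> R}) (Q : set R) : measurable Q ->
    (fine (P (V @^-1` Q)))%:E = P (V @^-1` Q).
  move=> mQ; rewrite fineK// fin_num_measure// -[V @^-1` Q]setTI.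
  exact: measurable_funP.
rewrite /F /= !fE// => h; rewrite -!muleA -h; congr (P _).
apply/seteqP; split=> w /=.
  move=> [[[h0 h1] h2] h3] j; rewrite !inE.
  by move=> /or4P[] /eqP ->.
move=> hj; repeat split.
- by apply: (hj i0); rewrite !inE eqxx.
- by apply: (hj i1); rewrite !inE eqxx ?orbT.
- by apply: (hj i2); rewrite !inE eqxx ?orbT.
- by apply: (hj i3); rewrite !inE eqxx ?orbT.
Qed.

Let law n : [/\ has_law P (S n) (law_given_pos P1 Y),
  has_law P (U n) (uniform_prob (@ltr01 R)) & has_law P (L n) (Lambda_law rho)].
Proof. by have [_ _ _ /(_ n)[]] := hTheta. Qed.

Let rho0 : 0 < rho. Proof. by case/andP : rho01. Qed.
Let rho1 : rho < 1. Proof. by case/andP : rho01. Qed.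

Let preT (V : {RV P >-> R}) : P (V @^-1` setT) = 1%E.
Proof. by rewrite preimage_setT; exact: probability_setT. Qed.

(** Conditioning [Y] on being positive costs a factor [1 / rho] in the stable tail. *)
Lemma S_tail : exists2 K, 0 <= K & forall (j : nat) n,
  (P [set w | (expR (dlt * j%:R) < S n w)%R] <=
    (K * expR (- (dlt * alpha)) ^+ j)%:E)%E.
Proof.
have [K K0 hK] := stable_tail alpha0 dlt0 hchar.
exists (K / rho); first by rewrite divr_ge0// ltW.
move=> j n; have [+ _ _] := law n.
move=> /(_ `]expR (dlt * j%:R), +oo[%classic (measurable_itv _)).
rewrite (_ : _ @^-1` _ = [set w | (expR (dlt * j%:R) < S n w)%R]); last first.
  by apply/seteqP; split=> w /=; rewrite in_itv/= andbT.
move=> ->; rewrite /law_given_pos hpos/= lee_fin mulrAC ler_wpM2r ?invr_ge0 ?(ltW rho0)//.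
have mA : measurable [set w | `]expR (dlt * j%:R), +oo[%classic (Y w) /\ 0 < Y w].
  rewrite (_ : [set w | _] = Y @^-1` (`]expR (dlt * j%:R), +oo[ `&` `]0, +oo[)).
    rewrite -[X in measurable X]setTI; apply: measurable_funP => //.
    exact: measurableI.
  by apply/seteqP; split=> w /=; rewrite !in_itv/= !andbT.
rewrite -lee_fin fineK ?fin_num_measure//; apply: le_trans (hK j).
apply: le_measure; rewrite ?inE//.
- rewrite (_ : [set w | _] = Y @^-1` `]expR (dlt * j%:R), +oo[%classic).
    by rewrite -[X in measurable X]setTI; apply: measurable_funP.
  by apply/seteqP; split=> w /=; rewrite in_itv/= andbT.
- by move=> w /= []; rewrite in_itv/= andbT.
Qed.

(* [Lambda_n U_n] has the law of [V^(1/rho)], so its moment of order [s] is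
   [rho / (rho + s)]. *)
Lemma integral_expR_F s n : 0 < s ->
  (\int[P]_w (expR (alpha * s * F_ alpha d (Theta^~ w) n))%:E =
    (expR (alpha * s * d) * (rho / (rho + s)))%:E)%E.
Proof.
move=> s0; have [_ UE LE] := law n.
have mp (V : {RV P >-> R}) : measurable_fun setT (fun w => V w `^ s).
  exact: (measurableT_comp (measurable_powR _)).
transitivity (\int[P]_w ((expR (alpha * s * d))%:E * (L n w `^ s * U n w `^ s)%:E))%E.
  apply: eq_integral => w _; rewrite -EFinM; congr (_%:E).
  have [_ /andP[u0 _] _ /andP[l0 _]] := Theta_calA n w.
  rewrite /F_ mulrDr expRD; congr (_ * _).
  rewrite -powRM ?ltW// /powR gt_eqF ?mulr_gt0//; congr expR.
  rewrite /lambda_ /u_ /=; field; rewrite gt_eqF//.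
rewrite ge0_integralZl_EFin ?expR_ge0//; last 2 first.
- by move=> w _; rewrite lee_fin mulr_ge0// powR_ge0.
- by apply/measurable_EFinP; exact: measurable_funM.
rewrite ge0_integralM_independent//; last 3 first.
- by move=> w; exact: powR_ge0.
- by move=> w; exact: powR_ge0.
- move=> A B mA mB.
  have mps : measurable_fun setT (fun x : R => x `^ s) by exact: measurable_powR.
  have mA' : measurable ((fun x : R => x `^ s) @^-1` A).
    by rewrite -[X in measurable X]setTI; exact: mps.
  have mB' : measurable ((fun x : R => x `^ s) @^-1` B).
    by rewrite -[X in measurable X]setTI; exact: mps.
  have := component_independent n measurableT mB' measurableT mA'.
  by rewrite !preT !preimage_setT setTI setIT mul1e mule1 setIC muleC.
rewrite (integral_Lambda_powR rho01 s0 LE).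
rewrite (integral_has_law (g := fun x => (x `^ s)%:E) UE)//; last 2 first.
- exact/measurable_EFinP.
- by move=> x; rewrite lee_fin powR_ge0.
rewrite integral_uniform_powR// -!EFinM; congr (_%:E); field.
by rewrite !gt_eqF// addr_gt0.
Qed.

Lemma prob_U_le n c : 0 <= c <= 1 -> (c%:E <= P (U n @^-1` `]-oo, c]%classic))%E.
Proof.
move=> c01; have [_ UE _] := law n.
rewrite -(uniform_prob_itv0 c01) -UE//.
apply: le_measure; rewrite ?inE.
- by rewrite -[X in measurable X]setTI; exact: measurable_funP.
- by rewrite -[X in measurable X]setTI; exact: measurable_funP.
- by move=> w /=; rewrite !in_itv/= => /andP[].
Qed.

(** When the Bernoulli variable is 1, the event is [V <= 2^(-rho)], so its probability is at least
    [(1 - rho) 2^(-rho)]. *)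
Lemma prob_L_half_gt0 n : (0 < P (L n @^-1` `]-oo, (2^-1)%R]%classic))%E.
Proof.
have [_ _ LE] := law n.
pose c : R := 2^-1 `^ rho.
have c0 : 0 < c by rewrite powR_gt0// invr_gt0.
have c1 : c <= 1.
  apply: (@le_trans _ _ (1 `^ rho)); last by rewrite powR1.
  rewrite ge0_ler_powR// ?nnegrE ?invr_ge0 ?(ltW rho0)//.
  by rewrite invf_le1// ler1n.
have c01 : 0 <= c <= 1 by rewrite (ltW c0).
pose H : set R := `]-oo, 2^-1]%classic.
have mH : measurable H by exact: measurable_itv.
have -> : P (L n @^-1` H) = (\int[P]_w (\1_H (L n w))%:E)%E.
  rewrite -[X in P X]setIT -integral_indic//.
  by rewrite -[X in measurable X]setTI; exact: measurable_funP.
rewrite (integral_has_Lambda_law (g := fun x => (\1_H x)%:E) rho01 LE); last 2 first.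
- by apply/measurable_EFinP; exact: measurable_indic.
- by move=> x; rewrite lee_fin.
apply: (@lt_le_trans _ _ ((1 - rho)%:E * c%:E)%E).
  by rewrite -EFinM lte_fin mulr_gt0// subr_gt0.
rewrite -[leLHS]add0e; apply: leeD; first by rewrite mule_ge0// lee_fin// ltW.
rewrite lee_wpmul2l ?lee_fin ?subr_ge0 ?(ltW rho1)//.
rewrite -(uniform_prob_itv0 c01) -[`[0, c]%classic in leLHS]setIT -integral_indic//.
apply: ge0_le_integral => //.
- by apply/measurable_EFinP; exact: measurable_indic.
- apply/measurable_EFinP; apply: measurableT_comp; first exact: measurable_indic.
  exact: measurable_powR.
- move=> v _; rewrite lee_fin !indicE; case: (boolP (v \in _)) => //.
  rewrite inE /= in_itv/= => /andP[v0 vc].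
  rewrite mem_set// /H/= in_itv/=.
  rewrite (_ : 2^-1 = c `^ rho^-1).
    by rewrite ge0_ler_powR// ?nnegrE ?invr_ge0 ?ltW// (le_trans v0).
  by rewrite /c -powRrM mulfV ?gt_eqF// powRr1// invr_ge0.
Qed.

(** With [S] bounded away from 0 and [Lambda <= 1/2], the function [a] exceeds any level once [U] is
    small; the three requirements are independent and each has positive probability. *)
Lemma prob_a_ge_gt0 (M : R) n : 0 < M ->
  (0 < P [set w | (M <= a_ alpha (Theta n w))%R])%E.
Proof.
move=> M0.
pose A m : set R := `]m.+1%:R^-1, +oo[%classic.
have mA m : measurable (A m) by exact: measurable_itv.
have [m Sm] : exists m, (0 < P (S n @^-1` A m))%E.
  apply: prob_bigcup_gt0 => [m|].
    by rewrite -[X in measurable X]setTI; apply: measurable_funP.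
  apply/seteqP; split=> // w _; have [S0 _ _ _] := Theta_calA n w.
  exists (Num.bound (S n w)^-1) => //; rewrite /A /preimage /= in_itv/= andbT.
  rewrite invf_plt ?posrE//; apply: lt_le_trans (archi_boundP _) _.
    by rewrite invr_ge0 ltW.
  by rewrite ler_nat.
pose s0 : R := m.+1%:R^-1.
have s00 : 0 < s0 by rewrite invr_gt0.
pose l0 : R := 2^-1 `^ (- alpha^-1) - 1.
have l00 : 0 < l0.
  rewrite subr_gt0 powRN -[ltLHS]invr1 ltf_pV2 ?posrE ?powR_gt0 ?invr_gt0//.
  apply: (@lt_le_trans _ _ (1 `^ alpha^-1)); last by rewrite powR1.
  rewrite gt0_ltr_powR ?invr_gt0// ?nnegrE ?invr_ge0//.
  by rewrite invf_lt1// ltr1n.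
(* [Q] is the size of [(1 - U) / U] that brings [a] up to [M], and [U <= c] with [c = 1 / (1 + Q)]
   guarantees it. *)
pose Q : R := (M / (l0 * s0)) `^ alpha.
have Q0 : 0 <= Q by exact: powR_ge0.
pose c : R := (1 + Q)^-1.
have Q1 : 0 < 1 + Q by rewrite ltr_pwDl.
have c0 : 0 < c by rewrite invr_gt0.
have c1 : c <= 1 by rewrite invf_le1// lerDl.
have c01 : 0 <= c <= 1 by rewrite (ltW c0).
have := component_independent n (measurable_itv `]s0, +oo[)
  (measurable_itv `]-oo, c]) measurableT (measurable_itv `]-oo, 2^-1]).
set B := (X in P X = _) => PB.
have PB0 : (0 < P B)%E.
  rewrite PB preT mule1 !mule_gt0//; last exact: prob_L_half_gt0.
  by apply: lt_le_trans (prob_U_le n c01); rewrite lte_fin.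
apply: lt_le_trans PB0 _; apply: le_measure; rewrite ?inE.
- rewrite /B; repeat apply: measurableI;
    by rewrite -[X in measurable X]setTI; apply: measurable_funP.
- rewrite (_ : [set w | _] = setT `&` (fun w => a_ alpha (Theta n w)) @^-1` `[M, +oo[%classic).
    exact: (measurable_a_ alpha measurable_Theta Theta_calA n).
  by rewrite setTI; apply/seteqP; split=> w /=; rewrite in_itv/= andbT.
- move=> w [[[/=]]]; rewrite !in_itv/= andbT => Sw Uw _ Lw.
  have [_ /andP[u0 _] _ /andP[L0 _]] := Theta_calA n w.
  rewrite /a_ /lambda_ /u_ /s_ /=.
  have h1 : l0 <= L n w `^ (- alpha^-1) - 1.
    rewrite lerD2r !powRN lef_pV2 ?posrE ?powR_gt0 ?invr_gt0//.
    by rewrite ge0_ler_powR// ?nnegrE ?invr_ge0 ?ltW.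
  have h2 : M / (l0 * s0) <= ((1 - U n w) / U n w) `^ alpha^-1.
    rewrite (_ : M / _ = Q `^ alpha^-1); last first.
      rewrite /Q -powRrM mulfV ?gt_eqF// powRr1// divr_ge0 ?mulr_ge0 ?ltW//.
    have QU : Q <= (1 - U n w) / U n w.
      rewrite ler_pdivlMr// lerBrDr.
      move: Uw; rewrite /c -[_^-1]mul1r ler_pdivlMr//; lra.
    by rewrite ge0_ler_powR// ?nnegrE ?invr_ge0 ?(ltW alpha0)// (le_trans Q0).
  have -> : M = l0 * (M / (l0 * s0)) * s0 by field; rewrite !gt_eqF.
  have MQ : 0 <= M / (l0 * s0) by rewrite divr_ge0 ?mulr_ge0// ltW.
  apply: ler_pM.
  - by rewrite mulr_ge0// ltW.
  - exact: ltW.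
  - by apply: ler_pM => //; exact: ltW.
  - exact: ltW.
Qed.

Lemma integral_sigma_lty :
  (\int[P]_w sigma_ alpha dlt d (Theta^~ w) < +oo)%E.
Proof.
have d0 : 0 < d by exact: lt_trans dltd.
have [s s0 r1] := exists_exp_moment_lt1 alpha0 rho0 d0 hd.
set r := (_ * _) in r1.
have r0 : 0 <= r by rewrite mulr_ge0 ?expR_ge0// divr_ge0 ?addr_ge0 ?ltW.
have [K K0 hK] := S_tail.
set q := expR (- (dlt * alpha)) in hK.
have q0 : 0 <= q by exact: expR_ge0.
have da0 : 0 < dlt * alpha by rewrite mulr_gt0.
have q1 : q < 1 by rewrite expR_lt1 oppr_lt0.
pose t := Num.max r q.
have t0 : 0 <= t by rewrite le_max r0.
have t1 : t < 1 by rewrite gt_max r1.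
have t01 : 0 <= t < 1 by rewrite t0.
have rt : r <= t by rewrite le_max lexx.
have qt : q <= t by rewrite le_max lexx orbT.
(* The constraints on [F] and on [S] each get a budget [eps * t^k], so that [c = 2 eps] gives
   exactly [c / (1 - t) = 1/2]. *)
pose eps := (1 - t) / 4.
have eps0 : 0 < eps by rewrite divr_gt0// subr_gt0.
have as0 : 0 < alpha * s by rewrite mulr_gt0.
(* Chosen so that the Chernoff factor [exp(- alpha s M)] is at most [eps]. *)
pose M := `|ln eps| / (alpha * s).
have M0 : 0 <= M by rewrite divr_ge0// ltW.
have hM : (expR (alpha * s * M))^-1 <= eps.
  rewrite -expRN -[leRHS]lnK ?posrE// ler_expR /M mulrC divfK ?gt_eqF//.
  by rewrite lerNl -normrN ler_norm.
(* Uses [q^j = exp(- dlt alpha j) <= 1 / (1 + dlt alpha j)]. *)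
have [j0 hj0] : exists j0, K * q ^+ j0 <= eps.
  exists (Num.bound (K / (eps * (dlt * alpha)))); set j := Num.bound _.
  rewrite /q -expRM_natr mulNr expRN ler_pdivrMr ?expR_gt0//.
  apply: (@le_trans _ _ (eps * (1 + dlt * alpha * j%:R))); last first.
    by rewrite ler_wpM2l ?(ltW eps0)// expR_ge1Dx.
  have : K / (eps * (dlt * alpha)) < j%:R.
    by apply/archi_boundP/divr_ge0 => //; exact: ltW (mulr_gt0 eps0 da0).
  by rewrite ltr_pdivrMr ?mulr_gt0//; nra.
pose c := eps + eps.
have ct : c / (1 - t) <= 2^-1.
  by rewrite ler_pdivrMr ?subr_gt0// /c /eps; lra.
pose G (x : R * R * R * R) : R :=
  expR (alpha * s * (d + alpha^-1 * ln (lambda_ x * u_ x))).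
have GE n w : G (X n w) = expR (alpha * s * F_ alpha d (Theta^~ w) (- n%:Z)) by [].
have mlam := @measurable_lambda_ R.
have mu_ := @measurable_u_ R.
have ms_ := @measurable_s_ R.
have mG : measurable_fun setT G.
  apply: measurableT_comp => //; apply: measurable_funM => //.
  apply: measurable_funD => //; apply: measurable_funM => //.
  by apply: (measurableT_comp (@measurable_ln R)); exact: measurable_funM.
have G0 x : 0 <= G x by exact: expR_ge0.
have Gr n : (\int[P]_w (G (X n w))%:E = r%:E)%E by exact: integral_expR_F.
pose D0 := expR M * ((1 + expR (dlt * j0%:R)) / (1 - expR (dlt - d))).
have D00 : 0 < D0.
  apply: mulr_gt0; first exact: expR_gt0.
  apply: divr_gt0; last by rewrite subr_gt0 expR_lt1 subr_lt0.
  by apply: addr_gt0 => //; exact: expR_gt0.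
pose Good n := [set w | D0 <= a_ alpha (X n w)].
(* The inequality [F_(-n-1) + .. + F_(-n-k-1) > M] in exponential form, which makes it a statement
   on a product of independent factors. *)
pose BadF n k := [set w | expR (alpha * s * M) < \prod_(i < k.+1) G (X (n.+1 + i)%N w)].
pose BadS n k := [set w | expR (dlt * (k + j0)%:R) < s_ (X (n + k.+1)%N w)].
(* Measurability of [a] is applied on the space carrying only the events of coordinate [n], to the
   constant sequence [X n]. *)
have mA n : @measurable_fun _ _ (g_sigma_algebraType (cylinder X [set n])) R setT
    (fun w => a_ alpha (X n w)).
  apply: (@measurable_a_ _ _ (g_sigma_algebraType (cylinder X [set n])) alpha
    (fun=> X n) _ _ 0).
    by move=> _; exact: measurable_coord.
  by move=> _ w; exact: Theta_calA.
have sGood n : sigma_coord X [set n] (Good n).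
  have := mA n (@measurableT _ (g_sigma_algebraType _)) `[D0, +oo[%classic
    (measurable_itv _).
  by rewrite setTI; congr sigma_coord; apply/seteqP; split=> w /=;
    rewrite in_itv/= andbT.
have PGood0 := prob_a_ge_gt0 0 D00.
have mGood n : measurable (Good n) by exact: sigma_coord_measurable (sGood n).
(* Equality of laws needs a measurable subset of the state space, so [a] is replaced by a measurable
   function that agrees with it on [calA]. *)
have PGoodE n : P (Good n) = P (Good 0).
  have [f mf fE] := a_measurable_on_calA alpha.
  have GoodE m : Good m = X m @^-1` (f @^-1` `[D0, +oo[).
    by apply/seteqP; split=> w; rewrite /Good /= in_itv/= andbT fE//;
      exact: Theta_calA.
  have mpre : measurable (f @^-1` `[D0, +oo[).
    by rewrite -[Z in measurable Z]setTI; exact: mf.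
  by rewrite !GoodE idX.
have sBadF n k : sigma_coord X [set j | (n < j <= n + k.+1)%N] (BadF n k).
  have := @sigma_coord_prod _ _ _ _ _ X _ mG n.+1 k.+1 (expR (alpha * s * M)).
  by apply: sigma_coord_sub => j /=; rewrite addSn ltnS.
have sBadS n k : sigma_coord X [set j | (n < j <= n + k.+1)%N] (BadS n k).
  have mc : @measurable_fun _ _ (g_sigma_algebraType
      (cylinder X [set j | (n < j <= n + k.+1)%N])) R setT
      (fun w => s_ (X (n + k.+1)%N w)).
    apply: (@measurableT_comp _ _ _ (g_sigma_algebraType _)) => //.
    by apply: measurable_coord; rewrite /= leqnn andbT addnS ltnS leq_addr.
  have := mc (@measurableT _ (g_sigma_algebraType _))
    `]expR (dlt * (k + j0)%:R), +oo[%classic (measurable_itv _).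
  by rewrite setTI; congr sigma_coord; apply/seteqP; split=> w /=;
    rewrite in_itv/= andbT.
have PBad n k : (P (BadF n k `|` BadS n k) <= (c * t ^+ k)%:E)%E.
  apply: (@le_trans _ _ (P (BadF n k) + P (BadS n k))%E).
    apply: measureU2; first exact: sigma_coord_measurable (sBadF n k).
    exact: sigma_coord_measurable (sBadS n k).
  rewrite /c mulrDl EFinD; apply: leeD.
    apply: (le_trans (prod_markov mX indX mG G0 Gr n.+1 k.+1 (expR_gt0 _))).
    rewrite lee_fin; apply: ler_pM.
    - by rewrite invr_ge0 expR_ge0.
    - exact: exprn_ge0.
    - exact: hM.
    - rewrite exprS; apply: (@le_trans _ _ (r ^+ k)).
        by rewrite ler_piMl ?exprn_ge0// ltW.
      by rewrite lerXn2r// nnegrE.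
  apply: (le_trans (hK (k + j0)%N (- (n + k.+1)%:Z))).
  rewrite lee_fin addnC exprD mulrA; apply: ler_pM.
  - by apply: mulr_ge0 => //; exact: exprn_ge0.
  - exact: exprn_ge0.
  - exact: hj0.
  - by rewrite lerXn2r// nnegrE.
have q'0 : 0 < fine (P (Good 0)).
  by rewrite fine_gt0// PGood0 ltey_eq fin_num_measure.
have c0 : 0 <= c by rewrite addr_ge0// ltW.
apply: (integral_return_time mX indX (Good := Good)
  (Bad := fun n k => BadF n k `|` BadS n k) q'0 c0 t01 ct sGood) => //.
- by move=> n; rewrite PGoodE fineK// fin_num_measure.
- move=> n k; apply: (@measurableU _ (g_sigma_algebraType (cylinder X _))).
    exact: sBadF.
  exact: sBadS.
- exact: measurable_sigma_ measurable_Theta Theta_calA.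
- move=> w; apply: le_ereal_inf_tmp => _ [n _ <-].
  by rewrite lee_fin.
move=> n w n0 gn bn; apply: ereal_inf_lbound; exists n => //; split => //.
apply: (@le_trans _ _ D0%:E); last by rewrite lee_fin.
apply: (D_bound alpha0 dltd (fun n => Theta_calA n w) M0).
- move=> k; rewrite -(ler_pM2l as0) -ler_expR.
  rewrite leNgt; apply/negP => h; apply: (bn k); left; rewrite /BadF/=.
  apply: lt_le_trans h _; rewrite mulr_sumr expR_sum.
  rewrite le_eqVlt; apply/orP; left; apply/eqP/eq_bigr => i _.
  by rewrite GE addSnnS PoszD opprD.
- move=> k; rewrite leNgt; apply/negP => h; apply: (bn k); right.
  rewrite /BadS /= /X; move: h.
  by rewrite PoszD opprD.
Qed.

End Model.

Theorem theorem2 (R : realType)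
    (alpha rho dlt d : R)
    (halpha : 0 < alpha <= 2) (hrho : 0 < rho < 1)
    (hdlt : 0 < dlt) (hdltd : dlt < d) (hd : d < (alpha * rho)^-1)
    (* the stable process *)
    (d1 : measure_display) (T1 : measurableType d1) (P1 : probability T1 R)
    (Y : R -> {RV P1 >-> R})
    (hstable : stable_process P1 alpha (fun t => Y t : T1 -> R))
    (hpos : P1 [set w | 0 < Y 1 w] = rho%:E)
    (hchar : forall t : R, char_fun P1 (Y 1) t = stable_char_fun alpha rho t)
    (* the sequence Theta *)
    (d2 : measure_display) (T : measurableType d2) (P : probability T R)
    (S U W L : int -> {RV P >-> R})
    (hTheta : Theta_sequence P1 (Y 1) rho S U W L) :
  let Theta := Theta_ S U W L in
  let Xi (n : int) := fun w : T => Xi_ alpha dlt d (Theta^~ w) n in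
  let sigma := fun w : T => sigma_ alpha dlt d (Theta^~ w) in
  let G0 : set (set T) := g_sigma_algebra_preimage (Xi 0) in
  {ae P, forall w, (sigma w < +oo)%E} /\
  (exists Z, is_cond_expectation P G0 sigma Z) /\
  (forall Z, is_cond_expectation P G0 sigma Z ->
     {ae P, forall w, (Z w < +oo)%E}).
Proof.
move=> Theta Xi sigma G0.
have [alpha0 _] := andP halpha.
have mTheta := @measurable_Theta _ _ _ _ S U W L.
have ThetaA := Theta_calA hTheta.
have msigma : measurable_fun setT sigma := measurable_sigma_ alpha dlt d mTheta ThetaA.
have mXi : measurable_fun setT (Xi 0) := measurable_Xi_ alpha dlt d mTheta ThetaA 0.
have sigma0 w : (0 <= sigma w)%E.
  by apply: le_ereal_inf_tmp => _ [n _ <-]; rewrite lee_fin.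
have sigma_lty : (\int[P]_w sigma w < +oo)%E.
  exact (integral_sigma_lty alpha0 hrho hdlt hdltd hd hpos hchar hTheta).
split; first exact: ge0_integral_lty_ae.
split; first exact: cond_expectation_exists.
move=> Z hZ; have [[_ G0m] _ GZ Z0 _] := hZ.
apply: ge0_integral_lty_ae => //.
  by move=> _ B mB; rewrite setTI; exact: G0m (GZ B mB).
by rewrite (integral_cond_expectation hZ).
Qed.
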